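(* Let $m,d,p\in\mathbb{N}$, $q\in\mathbb{N}_0$, and let $(Z_t)_{t\in\mathbb{Z}}$ be a weak white noise sequence in $\mathbb{C}^d$ with expectation $\mathbb{E}Z_0$ and covariance matrix $\Sigma$. Let $\Psi_1,\ldots,\Psi_p\in\mathbb{C}^{m\times m}$ and $\Theta_0,\ldots,\Theta_q\in\mathbb{C}^{m\times d}$, and define the matrix polynomials $$P(z):=\mathrm{Id}_m-\sum_{k=1}^p\Psi_kz^k,\qquad Q(z):=\sum_{k=0}^q\Theta_kz^k,\qquad z\in\mathbb{C}.$$ Let $U\in\mathbb{C}^{d\times d}$ be unitary such that $U\Sigma U^*=\begin{pmatrix}D&0_{s,d-s}\\0_{d-s,s}&0_{d-s,d-s}\end{pmatrix}$, where $D$ is a real $(s\times s)$-diagonal matrix with the strictly positive eigenvalues of $\Sigma$ on its diagonal for some $s\in\{0,\ldots,d\}$. (The matrix $U$ exists since $\Sigma$ is positive semidefinite.) Then the ARMA$(p,q)$ equation $$Y_t-\Psi_1Y_{t-1}-\ldots-\Psi_pY_{t-p}=\Theta_0Z_t+\ldots+\Theta_qZ_{t-q},\quad t\in\mathbb{Z},\qquad( * )$$ admits a weakly stationary solution $(Y_t)_{t\in\mathbb{Z}}$ if and only if the $\mathbb{C}^{m\times d}$-valued rational function $$z\mapsto M(z):=P^{-1}(z)Q(z)U^*\begin{pmatrix}\mathrm{Id}_s&0_{s,d-s}\\0_{d-s,s}&0_{d-s,d-s}\end{pmatrix}$$ has only removable singularities on the unit circle and there is some $g\in\mathbb{C}^m$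 such that $$P(1)\,g=Q(1)\,\mathbb{E}Z_0.$$ In that case, a weakly stationary solution of $( * )$ is given by $$Y_t=g+\sum_{j=-\infty}^\infty M_j\,U(Z_{t-j}-\mathbb{E}Z_0),\quad t\in\mathbb{Z},$$ where $M(z)=\sum_{j=-\infty}^\infty M_jz^j$ is the Laurent expansion of $M(z)$ in a neighbourhood of the unit circle, which converges absolutely there.
   Context: $\mathbb{N}=\{1,2,\ldots\}$, $\mathbb{N}_0=\mathbb{N}\cup\{0\}$. Vectors are column vectors; $A^*=\overline{A}^T$; $\mathrm{Id}_r$ is the $r\times r$ identity matrix and $0_{r,l}$ the zero matrix in $\mathbb{C}^{r\times l}$. A $\mathbb{C}^r$-valued process $(X_t)_{t\in\mathbb{Z}}$ is weakly stationary if each $X_t$ has finite second moment and if $\mathbb{E}X_t$ and $\mathrm{Cov}(X_t,X_{t+h})$ do not depend on $t\in\mathbb{Z}$ for each $h\in\mathbb{Z}$. If additionally every component of $X_t$ is uncorrelated with every component of $X_{t'}$ for $t\neq t'$, then $(X_t)_{t\in\mathbb{Z}}$ is called weak white noise. A solution of $( * )$ is any $\mathbb{C}^m$-valued process $(Y_t)_{t\in\mathbb{Z}}$, defined on the same probability space as $(Z_t)_{t\in\mathbb{Z}}$, satisfying $( * )$ almost surely. Since $\det P$ is a polynomial that is not identically zero, $P^{-1}$ is a matrix-valued rational function. The singularities of $M$ are the zeroes of $\det P(z)$, and such a singularity $z_0$ is removable if all entries of $M$ have removable singularities at $z_0$. *)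

(* Defs.v *)
From HB Require Import structures.
From mathcomp Require Import all_boot all_order all_algebra.
From mathcomp Require Import all_classical all_reals all_analysis.
From mathcomp Require Export complex.
Set Implicit Arguments.
Unset Strict Implicit.
Unset Printing Implicit Defensive.
Import Order.TTheory GRing.Theory Num.Theory.
Import numFieldNormedType.Exports.
Local Open Scope classical_set_scope.
Local Open Scope ring_scope.
Local Open Scope complex_scope.
Local Open Scope sesquilinear_scope.

(* Complex numbers are [R[i]] for [R : realType].  [R[i]] itself carries no
   canonical topology, so the analytic notions are defined over an arbitrary
   [K : numFieldType] (topologized by its norm) and used at [K := R[i]].     *)

Section Random.
Context {disp : measure_display} {T : measurableType disp} {R : realType}.
Variable Pr : probability T R.

Definition cexpectation (X : T -> R[i]) : R[i] :=
  fine ('E_Pr[fun w => complex.Re (X w)])%E +i*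
  fine ('E_Pr[fun w => complex.Im (X w)])%E.

Definition vexpectation r (X : T -> 'cV[R[i]]_r) : 'cV[R[i]]_r :=
  \col_i cexpectation (fun w => X w i 0).

(* Cov(X, Y) = E[(X - E X) (Y - E Y)^*] *)
Definition vcovariance r l (X : T -> 'cV[R[i]]_r) (Y : T -> 'cV[R[i]]_l) :
    'M[R[i]]_(r, l) :=
  \matrix_(i, j) cexpectation (fun w =>
    ((X w - vexpectation X) *m (Y w - vexpectation Y) ^t*) i j).

Definition random_vector r (X : T -> 'cV[R[i]]_r) : Prop :=
  forall i, measurable_fun setT (fun w => complex.Re (X w i 0)) /\
            measurable_fun setT (fun w => complex.Im (X w i 0)).

Definition finite_second_moment r (X : T -> 'cV[R[i]]_r) : Prop :=
  (\int[Pr]_w (\sum_i (complex.Re (X w i 0) ^+ 2 +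
                       complex.Im (X w i 0) ^+ 2))%:E < +oo)%E.

Definition process r (X : int -> T -> 'cV[R[i]]_r) : Prop :=
  forall t, random_vector (X t).

Definition weakly_stationary r (X : int -> T -> 'cV[R[i]]_r) : Prop :=
  [/\ process X,
      forall t, finite_second_moment (X t),
      forall t t', vexpectation (X t) = vexpectation (X t') &
      forall h t t', vcovariance (X t) (X (t + h)) =
                     vcovariance (X t') (X (t' + h))].

Definition weak_white_noise r (X : int -> T -> 'cV[R[i]]_r) : Prop :=
  weakly_stationary X /\
  forall t t', t <> t' -> vcovariance (X t) (X t') = 0.

Definition arma_solution m d (p q : nat) (Psi : nat -> 'M[R[i]]_m)
    (Theta : nat -> 'M[R[i]]_(m, d)) (Z : int -> T -> 'cV[R[i]]_d)
    (Y : int -> T -> 'cV[R[i]]_m) : Prop :=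
  process Y /\
  {ae Pr, forall w, forall t : int,
    Y t w - \sum_(1 <= k < p.+1) Psi k *m Y (t - k%:Z) w =
    \sum_(0 <= k < q.+1) Theta k *m Z (t - k%:Z) w}.

End Random.

Section Analytic.
Context {K : numFieldType}.

(* The two-sided series of the [a j], j in Z, converges absolutely to [S];
   [Negz n] is the integer -(n + 1).                                       *)
Definition has_sumZ (a : int -> K) (S : K) : Prop :=
  [/\ cvgn (series (fun n => `|a (Posz n)|)),
      cvgn (series (fun n => `|a (Negz n)|)) &
      S = limn (series (fun n => a (Posz n))) +
          limn (series (fun n => a (Negz n)))].

Definition mx_has_sumZ r l (a : int -> 'M[K]_(r, l)) (S : 'M[K]_(r, l)) :
    Prop :=
  forall i j, has_sumZ (fun n => a n i j) (S i j).

Definition removable_singularity (f : K -> K) (z0 : K) : Prop :=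
  exists g : K -> K,
    (\forall z \near z0, derivable g z 1) /\
    (\forall z \near z0^', f z = g z).

(* [sing] is the set of singularities of [f], where the value of the Coq
   function [f] is meaningless.                                           *)
Definition removable_on_unit_circle r l (sing : set K)
    (f : K -> 'M[K]_(r, l)) : Prop :=
  forall z0, `|z0| = 1 -> sing z0 ->
  forall i j, removable_singularity (fun z => f z i j) z0.

Definition laurent_near_unit_circle r l (sing : set K)
    (f : K -> 'M[K]_(r, l)) (a : int -> 'M[K]_(r, l)) : Prop :=
  exists e : K, 0 < e < 1 /\
  forall z, 1 - e < `|z| < 1 + e ->
  exists2 S, mx_has_sumZ (fun j => z ^ j *: a j) S & (~ sing z -> S = f z).

End Analytic.

Section Arma.
Context {R : realType}.
Local Notation C := R[i].

Definition arma_P m p (Psi : nat -> 'M[C]_m) (z : C) : 'M[C]_m :=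
  1%:M - \sum_(1 <= k < p.+1) z ^+ k *: Psi k.

Definition arma_Q m d q (Theta : nat -> 'M[C]_(m, d)) (z : C) :
    'M[C]_(m, d) :=
  \sum_(0 <= k < q.+1) z ^+ k *: Theta k.

Definition corner_mx s d (hs : (s <= d)%N) (A : 'M[C]_s) : 'M[C]_d :=
  castmx (subnKC hs, subnKC hs) (block_mx A 0 0 0).

(* Meaningful where [\det (arma_P p Psi z) != 0] ([invmx] is the identity on
   singular matrices); the remaining points are [arma_sing p Psi].          *)
Definition arma_M m d p q s (hs : (s <= d)%N) (Psi : nat -> 'M[C]_m)
    (Theta : nat -> 'M[C]_(m, d)) (U : 'M[C]_d) (z : C) : 'M[C]_(m, d) :=
  invmx (arma_P p Psi z) *m arma_Q q Theta z *m U ^t* *m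
  corner_mx hs 1%:M.

Definition arma_sing m p (Psi : nat -> 'M[C]_m) : set C :=
  [set z | \det (arma_P p Psi z) = 0].

End Arma.

(* Main.v *)
Require Import Defs.
From HB Require Import structures.
From mathcomp Require Import all_boot all_order all_algebra.
From mathcomp Require Import cyclic separable cyclotomic.
From mathcomp Require Import all_classical all_reals all_analysis.
From mathcomp Require Import measurable_realfun.
From mathcomp Require Import complex.
From mathcomp Require Import ring lra.
Set Implicit Arguments.
Unset Strict Implicit.
Unset Printing Implicit Defensive.
Import Order.TTheory GRing.Theory Num.Theory.
Import numFieldNormedType.Exports.
Local Open Scope classical_set_scope.
Local Open Scope ring_scope.
Local Open Scope complex_scope.

(** Write [B] for the backshift. A polynomial in [B] acts on two-sided sequences
    ([shift_act]), and polynomial matrices act on vectors of them ([mx_act]), so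
    that identities between polynomials turn into identities between filters.
    In the coordinates [W = U (Z - E Z)], whose components are uncorrelated with
    variances [D] followed by zeros, the centred equation reads
    [P(B) (Y - g) = QU(B) W] with [QU = Q U^*] ([arma_centred],
    [mx_act_rotated]). The constants split off exactly when
    [P(1) g = Q(1) E Z], which a stationary solution satisfies with [g = E Y]
    ([solution_mean]).

    Necessity of the condition on [M]. The adjugate of [P] reduces the system to
    scalar equations [delta(B) y = sum_k h_k(B) W_k] with [delta = det P] and [y]
    bounded in mean square, and the entries of [M] are the fractions
    [h_k / delta]. Applying an arbitrary polynomial [c] in [B] and comparing
    second moments gives
    [sum_k sig_k |c h_k|^2 = E |((c delta)(B) y)_0|^2],
    with the Euclidean norm of the coefficients on the left and a bound in terms
    of the coefficients of [c delta] on the right. If [h_k / delta], in lowest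
    terms, had a pole [lambda] on the unit circle, then taking for [c] products
    of the polynomials [(X^n - lambda^n) / (X - lambda)] would keep the right
    side bounded, because [X^n - lambda^n] has two coefficients of modulus one,
    while the left side grows linearly in [n]: at [lambda] such a quotient has
    modulus [n], and a polynomial of degree [n] with the value [n] at a point of
    the circle has squared norm at least of order [n] ([pole_free]). A
    nonvanishing denominator in lowest terms is the same as a removable
    singularity ([removable_fraction]).

    Sufficiency. Without poles on the circle, the entries of [M] have Laurent
    expansions there: Bezout splits a fraction into a power series in [z] and
    one in [1 / z], whose coefficients solve contracting recursions
    ([laurent_rational]). Any Laurent expansion of [M] is absolutely summable on
    the circle and has coefficients satisfying [P M = N], where [N] is [QU] on
    the coordinates of positive variance and zero on the other ones; this is the
    uniqueness of Laurent coefficients, proved by averaging over roots of unity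
    ([circle_coef_unique], [laurent_equation]). The series
    [sum_j M_j W_(t - j)] converges absolutely almost surely, and its partial
    sums are dominated by a square-integrable function ([filter_sum_sums],
    [filter_dom_integrable]); so its covariances are limits of those of the
    partial sums, and depend on time differences only ([ip_filter_sum]).
    Pathwise, [P(B)] acts on the coefficients of the filter, which gives
    [N(B) W], and this is [QU(B) W] almost surely because the degenerate
    coordinates of [W] vanish ([solution_solves]). *)

(** * Polynomials in the backshift operator *)

(** The action of the polynomial [p] in the backshift operator on the
    two-sided sequence [x]; it makes sequences a module over polynomials, so
    that identities between polynomials become identities between filters. *)
Definition shift_act (K : comNzRingType) (p : {poly K}) (x : int -> K) :
    int -> K :=
  fun t => \sum_(k < size p) p`_k * x (t - k%:Z).

Definition coef_int (K : comNzRingType) (p : {poly K}) (j : int) : K :=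
  match j with Posz n => p`_n | Negz _ => 0 end.

Section ShiftAct.
Variable K : comNzRingType.
Implicit Types (p q : {poly K}) (x y : int -> K) (t : int).

Lemma shift_act_widen n p x t : (size p <= n)%N ->
  shift_act p x t = \sum_(k < n) p`_k * x (t - k%:Z).
Proof.
move=> le_pn; rewrite /shift_act.
rewrite (big_ord_widen n (fun k : nat => p`_k * x (t - k%:Z)) le_pn).
rewrite big_mkcond; apply: eq_bigr => k _; case: ifPn => //.
by rewrite -leqNgt => ?; rewrite nth_default // mul0r.
Qed.

Lemma eq_shift_act p x y t : x =1 y -> shift_act p x t = shift_act p y t.
Proof. by move=> exy; apply: eq_bigr => k _; rewrite exy. Qed.

Lemma shift_act_addl p q x t :
  shift_act (p + q) x t = shift_act p x t + shift_act q x t.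
Proof.
pose n := maxn (size p) (size q).
rewrite (@shift_act_widen n (p + q)) ?size_polyD //.
rewrite (@shift_act_widen n p) ?leq_maxl // (@shift_act_widen n q) ?leq_maxr //.
by rewrite -big_split; apply: eq_bigr => k _; rewrite coefD mulrDl.
Qed.

Lemma shift_act0l x t : shift_act 0 x t = 0.
Proof. by rewrite /shift_act size_poly0 big_ord0. Qed.

Lemma shift_act_suml (I : Type) (r : seq I) (P : pred I) (F : I -> {poly K})
    x t :
  shift_act (\sum_(i <- r | P i) F i) x t =
  \sum_(i <- r | P i) shift_act (F i) x t.
Proof.
elim/big_rec2: _ => [|i y q _ IH]; first by rewrite shift_act0l.
by rewrite shift_act_addl IH.
Qed.

Lemma shift_actZXn (a : K) n x t :
  shift_act (a *: 'X^n) x t = a * x (t - n%:Z).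
Proof.
have le_n : (size (a *: 'X^n) <= n.+1)%N.
  by rewrite (leq_trans (size_scale_leq _ _)) ?size_polyXn.
rewrite (@shift_act_widen n.+1) // big_ord_recr /= big1 ?add0r.
  by rewrite coefZ coefXn eqxx mulr1.
move=> i _; rewrite coefZ coefXn.
by rewrite (_ : (i == n :> nat) = false) ?mulr0 ?mul0r // ltn_eqF.
Qed.

Lemma shift_actXn n x t : shift_act 'X^n x t = x (t - n%:Z).
Proof. by rewrite -['X^n]scale1r shift_actZXn mul1r. Qed.

Lemma shift_actX x t : shift_act 'X x t = x (t - 1).
Proof. by rewrite -['X]expr1 shift_actXn. Qed.

Lemma shift_actC (a : K) x t : shift_act a%:P x t = a * x t.
Proof. by rewrite -[a%:P]mulr1 mul_polyC -(expr0 'X) shift_actZXn subr0. Qed.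

Lemma shift_act1 x t : shift_act 1 x t = x t.
Proof. by rewrite -polyC1 shift_actC mul1r. Qed.

Lemma shift_act_addr p x y t :
  shift_act p (fun u => x u + y u) t = shift_act p x t + shift_act p y t.
Proof. by rewrite -big_split; apply: eq_bigr => k _; rewrite mulrDr. Qed.

Lemma shift_actZr p a x t :
  shift_act p (fun u => a * x u) t = a * shift_act p x t.
Proof.
by rewrite /shift_act big_distrr; apply: eq_bigr => k _; rewrite /= mulrCA.
Qed.

Lemma shift_actZl a p x t : shift_act (a *: p) x t = a * shift_act p x t.
Proof.
rewrite (@shift_act_widen (size p)) ?size_scale_leq // big_distrr.
by apply: eq_bigr => k _; rewrite coefZ /= mulrA.
Qed.

Lemma shift_act_sumr (I : Type) (r : seq I) (P : pred I) p (x : I -> int -> K)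
    t :
  shift_act p (fun u => \sum_(i <- r | P i) x i u) t =
  \sum_(i <- r | P i) shift_act p (x i) t.
Proof.
rewrite exchange_big; apply: eq_bigr => k _.
by rewrite big_distrr.
Qed.

Lemma shift_act_shift p x n t :
  shift_act p (fun u => x (u - n)) t = shift_act p x (t - n).
Proof. by apply: eq_bigr => k _; rewrite addrAC. Qed.

Lemma shift_actM p q x t :
  shift_act (p * q) x t = shift_act p (shift_act q x) t.
Proof.
elim/poly_ind: p t => [|p c IH] t; first by rewrite mul0r !shift_act0l.
rewrite mulrDl !shift_act_addl mul_polyC shift_actZl shift_actC; congr (_ + _).
have actMX r y u : shift_act (r * 'X) y u = shift_act r y (u - 1).
  rewrite -[r in r * _]coefK poly_def mulr_suml shift_act_suml.
  apply: eq_bigr => k _.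
  by rewrite -scalerAl -exprSr shift_actZXn -addn1 PoszD opprD addrA addrAC.
by rewrite actMX -mulrA -commr_polyX mulrA actMX IH.
Qed.

Lemma shift_act_cst p a t : shift_act p (fun=> a) t = p.[1] * a.
Proof.
rewrite horner_coef big_distrl; apply: eq_bigr => k _.
by rewrite expr1n mulr1.
Qed.

Lemma shift_act_coef_int p q j : shift_act p (coef_int q) j = coef_int (p * q) j.
Proof.
have act0 r (n : nat) : coef_int (r * 'X^n) =1 (fun j => coef_int r (j - n%:Z)).
  case=> [k|k]; last by rewrite NegzE -opprD -PoszD addSn -NegzE.
  rewrite /= coefMXn; case: ltnP => [lt_kn|le_nk]; last by rewrite subzn.
  rewrite -[Posz k - _]opprB subzn ?(ltnW lt_kn) //.
  by case: (n - k)%N (subn_gt0 k n) => [|l _]; [rewrite lt_kn|rewrite -NegzE].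
rewrite /shift_act -[p in RHS]coefK poly_def mulr_suml.
have ciD (I : Type) (r : seq I) (F : I -> {poly K}) :
    coef_int (\sum_(i <- r) F i) j = \sum_(i <- r) coef_int (F i) j.
  by case: j => k /=; [rewrite coef_sum | rewrite big1].
rewrite ciD; apply: eq_bigr => k _.
rewrite -scalerAl ['X^k * q]mulrC.
by rewrite -act0; case: (j) => n /=; rewrite ?coefZ ?mulr0.
Qed.

End ShiftAct.

(** * Absolutely convergent two-sided series *)

Section Limits.
Variable K : numFieldType.
Implicit Types (u v : nat -> K) (a b : int -> K).

(** Convergence of sequences, spelled out so that it can be used for complex
    numbers, on which the topology has to be inferred from the norm. *)
Definition conv u (l : K) :=
  forall e, 0 < e -> exists N, forall n, (N <= n)%N -> `|l - u n| < e.

Lemma cvg_conv u l : u @ \oo --> l <-> conv u l.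
Proof.
split=> [/cvgrPdist_lt ul e e_gt0|ul].
  by have [N _ HN] := ul e e_gt0; exists N => n; apply: HN.
by apply/cvgrPdist_lt => e e_gt0; have [N HN] := ul e e_gt0; exists N.
Qed.

Lemma conv_limn u l : conv u l -> limn u = l.
Proof. by move/cvg_conv; exact: cvg_lim. Qed.

Lemma conv_unique u l l' : conv u l -> conv u l' -> l = l'.
Proof. by move=> /conv_limn <- /conv_limn. Qed.

Lemma convD u v l l' : conv u l -> conv v l' ->
  conv (fun n => u n + v n) (l + l').
Proof. by move=> /cvg_conv ? /cvg_conv ?; apply/cvg_conv; exact: cvgD. Qed.

Lemma convN u l : conv u l -> conv (fun n => - u n) (- l).
Proof. by move=> /cvg_conv ?; apply/cvg_conv; exact: cvgN. Qed.

Lemma convZ c u l : conv u l -> conv (fun n => c * u n) (c * l).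
Proof. by move=> /cvg_conv ?; apply/cvg_conv; exact: cvgMr. Qed.

Lemma convM u v l l' : conv u l -> conv v l' ->
  conv (fun n => u n * v n) (l * l').
Proof. by move=> /cvg_conv ul /cvg_conv vl; apply/cvg_conv; exact: cvgM. Qed.

Lemma conv_cst l : conv (fun=> l) l.
Proof. by move=> e e_gt0; exists 0%N => n _; rewrite subrr normr0. Qed.

Lemma eq_conv u v l : u =1 v -> conv u l -> conv v l.
Proof. by move=> /funext ->. Qed.

(** Pairing the indices [n] and [-(n + 1)] gives a two-sided series a single
    sequence of partial sums, over the windows [-n <= j < n]. *)
Definition wsum a n : K := \sum_(j < n) (a (Posz j) + a (Negz j)).

Definition summableZ a := exists B, forall n, wsum (fun j => `|a j|) n <= B.

(** A two-sided series with an absolutely convergent sum; on complex numbers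
    this is [has_sumZ], with a single sequence of partial sums. *)
Definition sumsZ a S := summableZ a /\ conv (wsum a) S.

Lemma wsumS a n : wsum a n.+1 = wsum a n + (a (Posz n) + a (Negz n)).
Proof. by rewrite /wsum big_ord_recr. Qed.

Lemma wsumD a b n : wsum (fun j => a j + b j) n = wsum a n + wsum b n.
Proof. by rewrite -big_split; apply: eq_bigr => j _; rewrite addrACA. Qed.

Lemma wsumZ c a n : wsum (fun j => c * a j) n = c * wsum a n.
Proof. by rewrite [RHS]big_distrr; apply: eq_bigr => j _; rewrite /= mulrDr. Qed.

Lemma wsum_ge0 a n : (forall j, 0 <= a j) -> 0 <= wsum a n.
Proof. by move=> a_ge0; apply: sumr_ge0 => j _; rewrite addr_ge0. Qed.

Lemma le_wsum a b n : (forall j, a j <= b j) -> wsum a n <= wsum b n.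
Proof. by move=> le_ab; apply: ler_sum => j _; rewrite lerD. Qed.

Lemma wsum_nd a m n : (forall j, 0 <= a j) -> (m <= n)%N ->
  wsum a m <= wsum a n.
Proof.
move=> a_ge0 /subnK <-; elim: (n - m)%N => // k IH.
by rewrite addSn wsumS (le_trans IH) // lerDl addr_ge0.
Qed.

Lemma series_nd u m n : (forall k, 0 <= u k) -> (m <= n)%N ->
  series u m <= series u n.
Proof.
move=> u_ge0; rewrite !seriesEnat; exact: (@nondecreasing_series _ u xpredT).
Qed.

Lemma norm_wsum a n : `|wsum a n| <= wsum (fun j => `|a j|) n.
Proof.
apply: le_trans (ler_norm_sum _ _ _) _.
by apply: ler_sum => j _; apply: ler_normD.
Qed.

Lemma le_summableZ a b : (forall j, `|a j| <= `|b j|) -> summableZ b ->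
  summableZ a.
Proof. by move=> ab [B b_le]; exists B => n; apply: le_trans (le_wsum n ab) _. Qed.

Lemma summableZ_le a B : (forall n, wsum (fun j => `|a j|) n <= B) ->
  forall j, `|a j| <= B.
Proof.
move=> a_le [n|n]; apply: le_trans (a_le n.+1); rewrite wsumS.
  by rewrite addrCA lerDl addr_ge0 // wsum_ge0.
by rewrite addrA lerDr addr_ge0 // wsum_ge0.
Qed.

Lemma summableZD a b : summableZ a -> summableZ b ->
  summableZ (fun j => a j + b j).
Proof.
move=> [A a_le] [B b_le]; exists (A + B) => n.
apply: le_trans (lerD (a_le n) (b_le n)); rewrite -wsumD.
by apply: le_wsum => j; apply: ler_normD.
Qed.

Lemma summableZZ c a : summableZ a -> summableZ (fun j => c * a j).
Proof.
move=> [A a_le]; exists (`|c| * A) => n.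
under eq_fun do rewrite normrM; rewrite wsumZ.
exact: ler_wpM2l.
Qed.

Lemma sumsZD a b S S' : sumsZ a S -> sumsZ b S' ->
  sumsZ (fun j => a j + b j) (S + S').
Proof.
move=> [a_s a_c] [b_s b_c]; split; first exact: summableZD.
by apply: eq_conv (convD a_c b_c) => n; rewrite wsumD.
Qed.

Lemma sumsZZ c a S : sumsZ a S -> sumsZ (fun j => c * a j) (c * S).
Proof.
move=> [a_s a_c]; split; first exact: summableZZ.
by apply: eq_conv (convZ c a_c) => n; rewrite wsumZ.
Qed.

Lemma sumsZ0 : sumsZ (fun=> 0) 0.
Proof.
split; first by exists 0 => n; rewrite /wsum big1 // => j _; rewrite normr0 addr0.
by apply: eq_conv (conv_cst 0) => n; rewrite /wsum big1 // => j _; rewrite addr0.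
Qed.

Lemma eq_sumsZ a b S : a =1 b -> sumsZ a S -> sumsZ b S.
Proof. by move=> /funext ->. Qed.

Lemma sumsZ_sum (I : Type) (r : seq I) (P : pred I) (a : I -> int -> K) S :
  (forall i, P i -> sumsZ (a i) (S i)) ->
  sumsZ (fun j => \sum_(i <- r | P i) a i j) (\sum_(i <- r | P i) S i).
Proof.
move=> aS; elim: r => [|i r IH].
  by rewrite big_nil; apply: eq_sumsZ sumsZ0 => j; rewrite big_nil.
rewrite big_cons; case: ifPn => Pi.
  by apply: eq_sumsZ (sumsZD (aS i Pi) IH) => j; rewrite big_cons Pi.
by apply: eq_sumsZ IH => j; rewrite big_cons (negPf Pi).
Qed.

Lemma sumsZ_unique a S S' : sumsZ a S -> sumsZ a S' -> S = S'.
Proof. by move=> [_ aS] [_ aS']; exact: conv_unique aS aS'. Qed.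

Lemma sumsZ_coef_int1 x t : sumsZ (fun j => coef_int 1 j * x (t - j)) (x t).
Proof.
have w1 (y : int -> K) n :
    wsum (fun j => coef_int 1 j * y (t - j)) n.+1 = y t.
  rewrite /wsum big_ord_recl big1 => [|i _] /=.
    by rewrite coef1 mul1r mul0r !addr0.
  by rewrite coef1 !mul0r addr0.
have nE : (fun j => `|coef_int 1 j * x (t - j)|) =
          (fun j => coef_int 1 j * `|x (t - j)|).
  apply/funext => -[j|j] /=; rewrite normrM ?coef1 ?normr0 ?mul0r//.
  by rewrite normr_nat.
split=> [|e e_gt0].
  exists `|x t| => n; rewrite nE; apply: (@le_trans _ _ (wsum _ n.+1)).
    by apply: wsum_nd => // -[k|k] /=; rewrite ?coef1 ?mulr_ge0 ?mul0r ?ler0n.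
  by rewrite (w1 (fun t => `|x t|)).
by exists 1%N; case=> [//|n] _; rewrite w1 subrr normr0.
Qed.

End Limits.

Section ComplexSeries.
Variable R : realType.
Local Notation C := R[i].
Implicit Types (u v : nat -> C) (a b : int -> C).

Lemma norm_le_ReIm (z : C) :
  `|z| <= (`|complex.Re z| + `|complex.Im z|)%:C.
Proof.
have -> : z = (complex.Re z)%:C + 'i%C * (complex.Im z)%:C by exact: complexE.
apply: le_trans (ler_normD _ _) _; rewrite rmorphD /= normrM.
have -> : `|'i%C| = 1 :> C by rewrite normc_def /= expr0n expr1n add0r sqrtr1.
rewrite mul1r !normc_def /= !expr0n /= !addr0 !sqrtr_sqr.
by rewrite !(mul0r, mulr0, mul1r, subr0, addr0, add0r).
Qed.

Lemma normr_Re_le (z : C) : `|complex.Re z|%:C <= `|z|.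
Proof. exact: normc_ge_Re. Qed.

Lemma normr_Im_le (z : C) : `|complex.Im z|%:C <= `|z|.
Proof.
rewrite normc_def lecR -sqrtr_sqr ler_sqrt ?lerDr ?sqr_ge0 //.
by rewrite addr_ge0 ?sqr_ge0.
Qed.

(** This is how the completeness of the reals and the convergence theorems for
    real integrals are applied to complex numbers. *)
Lemma conv_ReIm u (l : C) : conv u l <->
  (@complex.Re R \o u @ \oo --> complex.Re l) /\
  (@complex.Im R \o u @ \oo --> complex.Im l).
Proof.
split=> [ul|[/cvg_conv Rl /cvg_conv Il] e e_gt0].
  split; apply/cvg_conv => e e_gt0.
    have [|N HN] := ul e%:C; first by rewrite ltcR.
    exists N => n /HN; rewrite -ltcR; apply: le_lt_trans.
    by rewrite -raddfB; apply: normr_Re_le.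
  have [|N HN] := ul e%:C; first by rewrite ltcR.
  exists N => n /HN; rewrite -ltcR; apply: le_lt_trans.
  by rewrite -raddfB; apply: normr_Im_le.
have e_real : e = (complex.Re e)%:C by rewrite RRe_real // gtr0_real.
rewrite e_real ltcR in e_gt0 *.
have e2_gt0 : 0 < complex.Re e / 2 by rewrite divr_gt0.
have [N1 H1] := Rl _ e2_gt0; have [N2 H2] := Il _ e2_gt0.
exists (maxn N1 N2) => n; rewrite geq_max => /andP[/H1 h1 /H2 h2].
apply: le_lt_trans (norm_le_ReIm _) _.
by rewrite !raddfB /= ltcR [ltRHS]splitr ltrD.
Qed.

Lemma nd_bounded_conv (u : nat -> C) (B : C) :
  (forall n, 0 <= u n) -> (forall m n, (m <= n)%N -> u m <= u n) ->
  (forall n, u n <= B) -> exists l, conv u l.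
Proof.
move=> u_ge0 u_nd u_le.
have uE n : u n = (complex.Re (u n))%:C by rewrite RRe_real // ger0_real.
have /cvg_ex[l ul] : cvgn (@complex.Re R \o u).
  apply: nondecreasing_is_cvgn.
    by move=> m n /u_nd; rewrite lecE => /andP[].
  exists (complex.Re B) => _ [n _ <-]; move: (u_le n).
  by rewrite lecE => /andP[].
exists l%:C; apply/conv_ReIm; split=> //=.
rewrite (_ : _ \o _ = fun=> 0); first exact: cvg_cst.
by apply/funext => n /=; rewrite uE.
Qed.

Lemma abs_conv (u : nat -> C) (B : C) :
  (forall n, series (fun k => `|u k|) n <= B) -> exists l, conv (series u) l.
Proof.
move=> u_le.
have part (f : C -> R) : {morph f : x y / x + y} -> f 0 = 0 ->
    (forall z, `|f z|%:C <= `|z|) -> exists l : R, f \o series u @ \oo --> l.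
  move=> fD f0 f_le; suff /cvg_ex[l fl] : cvgn (f \o series u) by exists l.
  rewrite (_ : f \o _ = series (f \o u)); last first.
    by apply/funext => n; rewrite /= !seriesEord /= (big_morph f fD f0).
  apply: normed_cvg; apply: nondecreasing_is_cvgn.
    by move=> m n; apply: (@series_nd R (fun k => `|f (u k)|)).
  exists (complex.Re B) => _ [n _ <-].
  suff: (series (fun k => `|f (u k)|) n)%:C <= B by rewrite lecE => /andP[].
  apply: le_trans (u_le n); rewrite !seriesEord rmorph_sum.
  by apply: ler_sum => k _; apply: f_le.
have [l1 ul1] := part _ (raddfD _) (raddf0 _) normr_Re_le.
have [l2 ul2] := part _ (raddfD _) (raddf0 _) normr_Im_le.
by exists (l1 +i* l2); apply/conv_ReIm; split.
Qed.

Lemma wsum_series a n : wsum a n =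
  series (fun n => a (Posz n)) n + series (fun n => a (Negz n)) n.
Proof. by rewrite !seriesEord -big_split. Qed.

Lemma has_sumZP a S : has_sumZ a S <-> sumsZ a S.
Proof.
have bounded (u : nat -> C) : (exists l, conv (series (fun k => `|u k|)) l) ->
    exists B, forall n, series (fun k => `|u k|) n <= B.
  move=> [l /(_ 1 ltr01)[N HN]]; exists (`|l| + 1) => n.
  pose s := series (fun k => `|u k|).
  have s_nd : s n <= s (maxn n N).
    by apply: series_nd => //; exact: leq_maxl.
  apply: le_trans s_nd _.
  have s_ge0 : 0 <= s (maxn n N).
    by rewrite /s seriesEord; apply: sumr_ge0 => i _.
  rewrite -(ger0_norm s_ge0) -[s _](subrK l) addrC.
  apply: le_trans (ler_normD _ _) _; rewrite lerD2l distrC ltW //.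
  by apply: HN; rewrite leq_maxr.
have abs_nd (u : nat -> C) B : (forall n, series (fun k => `|u k|) n <= B) ->
    exists l, conv (series (fun k => `|u k|)) l.
  apply: nd_bounded_conv => [n|m n le_mn].
    by rewrite seriesEord; apply: sumr_ge0 => i _.
  by apply: series_nd.
split=> [[/cvg_ex[l1 /cvg_conv c1] /cvg_ex[l2 /cvg_conv c2] ->]|].
  have [|B1 b1] := bounded (fun n => a (Posz n)); first by exists l1.
  have [|B2 b2] := bounded (fun n => a (Negz n)); first by exists l2.
  have [s1 cs1] := abs_conv b1; have [s2 cs2] := abs_conv b2.
  rewrite (conv_limn cs1) (conv_limn cs2); split.
    by exists (B1 + B2) => n; rewrite wsum_series lerD.
  by apply: eq_conv (convD cs1 cs2) => n; rewrite wsum_series.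
move=> [[B a_le] aS].
have b1 n : series (fun k => `|a (Posz k)|) n <= B.
  apply: le_trans (a_le n); rewrite wsum_series lerDl.
  by rewrite seriesEord; apply: sumr_ge0 => i _.
have b2 n : series (fun k => `|a (Negz k)|) n <= B.
  apply: le_trans (a_le n); rewrite wsum_series lerDr.
  by rewrite seriesEord; apply: sumr_ge0 => i _.
have [l1 c1] := abs_nd _ _ b1; have [l2 c2] := abs_nd _ _ b2.
have [s1 cs1] := abs_conv b1; have [s2 cs2] := abs_conv b2.
split.
- by apply/cvg_ex; exists l1; apply/cvg_conv.
- by apply/cvg_ex; exists l2; apply/cvg_conv.
- rewrite (conv_limn cs1) (conv_limn cs2); apply: conv_unique aS _.
  by apply: eq_conv (convD cs1 cs2) => n; rewrite wsum_series.
Qed.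

Lemma summableZ_sums a : summableZ a -> exists S, sumsZ a S.
Proof.
move=> a_s; have [B a_le] := a_s.
have [|s1 cs1] := @abs_conv (fun n => a (Posz n)) B.
  move=> n; apply: le_trans (a_le n); rewrite wsum_series lerDl.
  by rewrite seriesEord; apply: sumr_ge0 => i _.
have [|s2 cs2] := @abs_conv (fun n => a (Negz n)) B.
  move=> n; apply: le_trans (a_le n); rewrite wsum_series lerDr.
  by rewrite seriesEord; apply: sumr_ge0 => i _.
exists (s1 + s2); split=> //.
by apply: eq_conv (convD cs1 cs2) => n; rewrite wsum_series.
Qed.

Lemma summableZ_tail a : summableZ a -> forall e, 0 < e ->
  exists N, forall m n, (N <= m)%N -> (m <= n)%N ->
    wsum (fun j => `|a j|) n - wsum (fun j => `|a j|) m < e.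
Proof.
move=> [B a_le] e e_gt0.
have [||l al] := @nd_bounded_conv (wsum (fun j => `|a j|)) B _ _ a_le.
- by move=> n; apply: wsum_ge0.
- by move=> m n; apply: wsum_nd.
have e2_gt0 : 0 < e / 2 by rewrite divr_gt0.
have [N HN] := al _ e2_gt0; exists N => m n le_Nm le_mn.
have /HN lm := le_Nm; have /HN ln := leq_trans le_Nm le_mn.
have d_ge0 : 0 <= wsum (fun j => `|a j|) n - wsum (fun j => `|a j|) m.
  by rewrite subr_ge0 wsum_nd.
rewrite -(ger0_norm d_ge0) -(subrKA l) [ltRHS]splitr.
by apply: le_lt_trans (ler_normD _ _) _; rewrite ltrD // distrC.
Qed.

Lemma wsum_shift (K : numFieldType) (a : int -> K) n :
  wsum (fun j => a (j - 1)) n = wsum a n + a (Negz n) - a (n%:Z - 1).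
Proof.
elim: n => [|n IH]; first by rewrite /wsum !big_ord0 add0r subrr.
have -> : n.+1%:Z - 1 = n%:Z by rewrite -addn1 PoszD addrK.
have eN : Negz n - 1 = Negz n.+1 by rewrite !NegzE -opprD -PoszD addn1.
by rewrite !wsumS IH eN addrA subrK [in RHS]addrC -!addrA [in RHS]addrCA addKr.
Qed.

(** Shifting the index only changes the partial sums by two terms, and the
    terms of a summable series vanish at infinity. *)
Lemma sumsZ_shift1 a S : sumsZ a S -> sumsZ (fun j => a (j - 1)) S.
Proof.
move=> [a_s aS]; have [B a_le] := a_s; split.
  exists (B + B) => n; rewrite (wsum_shift (fun j => `|a j|)).
  apply: le_trans (_ : wsum (fun j => `|a j|) n + `|a (Negz n)| <= _).
    by rewrite gerDl oppr_le0.
  by rewrite lerD // (summableZ_le a_le).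
have term0 j : (forall n, j n = Posz n \/ j n = Negz n) -> conv (fun n => a (j n)) 0.
  move=> jE e /(summableZ_tail a_s)[N HN]; exists N => n le_Nn.
  rewrite sub0r normrN; apply: le_lt_trans (HN n n.+1 le_Nn (leqnSn n)).
  by rewrite wsumS addrC addKr; case: (jE n) => ->; rewrite ?lerDl ?lerDr.
have c1 : conv (fun n => a (Negz n)) 0 by apply: term0; right.
have c2 : conv (fun n => a (n%:Z - 1)) 0.
  have c2' : conv (fun n => a (Posz n)) 0 by apply: term0; left.
  move=> e /c2'[N HN]; exists N.+1; case=> [//|n] /HN.
  by rewrite -addn1 PoszD addrK.
have := convD (convD aS c1) (convN c2); rewrite oppr0 !addr0.
by apply: eq_conv => n; rewrite wsum_shift.
Qed.

Lemma sumsZ_shift a S (n : nat) : sumsZ a S -> sumsZ (fun j => a (j - n%:Z)) S.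
Proof.
elim: n => [|n IH] aS; first by apply: eq_sumsZ aS => j; rewrite subr0.
apply: eq_sumsZ (sumsZ_shift1 (IH aS)) => j.
by rewrite -addn1 PoszD opprD addrA addrAC.
Qed.

(** Each power of the backshift moves the output of a two-sided filter in time,
    which amounts to moving the index of its coefficients. *)
Lemma sumsZ_shift_act (p : {poly C}) a (w x : int -> C) t :
  (forall t, sumsZ (fun j => a j * w (t - j)) (x t)) ->
  sumsZ (fun j => shift_act p a j * w (t - j)) (shift_act p x t).
Proof.
move=> ax; have -> : (fun j => shift_act p a j * w (t - j)) =
    (fun j => \sum_(k < size p) p`_k * (a (j - k%:Z) * w (t - j))).
  by apply/funext => j; rewrite mulr_suml; apply: eq_bigr => k _; rewrite mulrA.
apply: sumsZ_sum => k _; apply: sumsZZ.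
apply: eq_sumsZ (sumsZ_shift k (ax (t - k%:Z))) => j.
by rewrite opprB addrA subrK.
Qed.

Lemma sumsZ_coef_int (p : {poly C}) (w : int -> C) t :
  sumsZ (fun j => coef_int p j * w (t - j)) (shift_act p w t).
Proof.
have := @sumsZ_shift_act p (coef_int 1) w w t (sumsZ_coef_int1 w).
by apply: eq_sumsZ => j; rewrite shift_act_coef_int mulr1.
Qed.

End ComplexSeries.

(** * Uniqueness of Laurent coefficients *)

Lemma closed_prim_root_exists (F : numClosedFieldType) n : (0 < n)%N ->
  exists z : F, n.-primitive_root z.
Proof.
pose p : {poly F} := 'X^n - 1; have [r Dp] := closed_field_poly_normal p.
move=> n_gt0; rewrite (monicP _) ?monicXnsubC // scale1r in Dp.
have rn1 : all n.-unity_root r by apply/allP=> z; rewrite -root_prod_XsubC -Dp.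
have sz_r : (n < (size r).+1)%N.
  by rewrite -(size_prod_XsubC r id) -Dp size_XnsubC.
have [|z] := hasP (has_prim_root n_gt0 rn1 _ sz_r); last by exists z.
by rewrite -separable_prod_XsubC -Dp separable_Xn_sub_1 // pnatr_eq0 -lt0n.
Qed.

Section Uniqueness.
Variable R : realType.
Local Notation C := R[i].
Implicit Types (a b : int -> C).

Lemma wsum_pick (K : numFieldType) (j0 : int) (x : K) n : (`|j0| < n)%N ->
  wsum (fun j => if j == j0 then x else 0) n = x.
Proof.
move=> j0n; have [k] : exists k : 'I_n, j0 = Posz k \/ j0 = Negz k.
  case: j0 j0n => k /= kn; first by exists (Ordinal kn); left.
  by exists (Ordinal (ltnW kn)); right.
case=> ->; rewrite /wsum (bigD1 k) //= eqxx big1 ?addr0 ?add0r //.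
  move=> i ik; rewrite addr0 ifF //; apply/negbTE; apply: contra ik.
  by move=> /eqP[/val_inj ->].
move=> i ik; rewrite add0r ifF //; apply/negbTE; apply: contra ik.
by move=> /eqP[/val_inj ->].
Qed.

Definition outside m a (j : int) : C :=
  if (match j with Posz k => k | Negz k => k end < m)%N then 0 else a j.

Lemma wsum_outside m a n : (m <= n)%N ->
  wsum (outside m a) n = wsum a n - wsum a m.
Proof.
move=> /subnK <-; elim: (n - m)%N => [|k IH].
  rewrite add0n subrr /wsum big1 // => j _.
  by rewrite /outside /= ltn_ord addr0.
rewrite addSn !wsumS IH /outside /= ltnNge leq_addl /=.
by rewrite [RHS]addrAC.
Qed.

(** Averaging over the [N]-th roots of unity keeps the coefficient at [j0] and
    kills all the other ones in the window [|j - j0| < N]; the remaining ones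
    are in the tail of an absolutely convergent series. *)
Lemma circle_coef_unique a : summableZ a ->
  (forall z, `|z| = 1 -> sumsZ (fun j => z ^ j * a j) 0) -> forall j, a j = 0.
Proof.
move=> a_s az j0; apply/eqP; rewrite -normr_le0.
have nz_ge0 : 0 <= `|a j0| by [].
suff le_e e : 0 < e -> `|a j0| <= e + e.
  have Re_le : complex.Re `|a j0| <= 0.
    apply/ler_addgt0Pr => e e_gt0; rewrite add0r.
    have := le_e (e / 2)%:C; rewrite ltcR divr_gt0 // => /(_ isT).
    by rewrite -rmorphD -splitr lecE => /andP[].
  by rewrite lecE Re_le andbT ger0_Im.
move=> e_gt0; have [m0 tail] := summableZ_tail a_s e_gt0.
pose m := (maxn m0 `|j0|.+1)%N; pose N := (m + m).+1.
have [w w_prim] := closed_prim_root_exists R[i] (ltn0Sn (m + m)).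
have wN : w ^+ N = 1 by apply: prim_expr_order.
have nw : `|w| = 1.
  by apply/eqP; rewrite -(@pexpr_eq1 _ _ N) // -normrX wN normr1.
have w_neq0 : w != 0 by rewrite -normr_gt0 nw ltr01.
(* [c j] is the average over the [N]-th roots of unity [z] of [z ^ (j - j0)]. *)
pose c (j : int) : C := N%:R^-1 * \sum_(l < N) (w ^+ l) ^ (- j0) * (w ^+ l) ^ j.
have cb : sumsZ (fun j => c j * a j) 0.
  have : sumsZ (fun j => N%:R^-1 *
      \sum_(l < N) (w ^+ l) ^ (- j0) * ((w ^+ l) ^ j * a j))
      (N%:R^-1 * \sum_(l < N) (w ^+ l) ^ (- j0) * 0).
    apply: sumsZZ; apply: sumsZ_sum => l _; apply: sumsZZ.
    by apply: az; rewrite normrX nw expr1n.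
  rewrite big1 ?mulr0 => [|l _]; last by rewrite mulr0.
  apply: eq_sumsZ => j; rewrite /c -mulrA; congr (_ * _).
  by rewrite mulr_suml; apply: eq_bigr => l _; rewrite mulrA.
have nwz (j : int) : `|w ^ j| = 1.
  by case: j => k; rewrite /exprz ?normfV normrX nw expr1n ?invr1.
have cE j : c j = N%:R^-1 * \sum_(l < N) (w ^ (j - j0)) ^+ l.
  rewrite /c; congr (_ * _); apply: eq_bigr => l _.
  rewrite -expfzDr ?expf_neq0 // addrC (exprnP w l) (exprnP (w ^ _) l).
  by rewrite exprzAC.
have c_le1 j : `|c j| <= 1.
  rewrite cE normrM normfV normr_nat mulrC ler_pdivrMr ?ltr0n // mul1r.
  apply: le_trans (ler_norm_sum _ _ _) _.
  rewrite (eq_bigr (fun=> 1)) => [|l _]; last by rewrite normrX nwz expr1n.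
  by rewrite sumr_const card_ord.
have cj0 : c j0 = 1.
  rewrite cE subrr expr0z (eq_bigr (fun=> 1)) => [|l _]; last by rewrite expr1n.
  by rewrite sumr_const card_ord mulVf // pnatr_eq0.
have c_eq0 j : j != j0 -> (`|j - j0| < N)%N -> c j = 0.
  move=> jj0 lt_N; rewrite cE; set u := w ^ _.
  have u1 : u != 1.
    have k_neq0 : (0 < `|(j - j0)%R|)%N by rewrite absz_gt0 subr_eq0.
    have wk : w ^+ `|(j - j0)%R| != 1.
      rewrite -(prim_order_dvd w_prim); apply/negP => /(dvdn_leq k_neq0).
      by rewrite leqNgt lt_N.
    move: wk; rewrite /u; case: (j - j0) => k //= wk.
    by rewrite /exprz invr_eq1.
  have uN : u ^+ N = 1 by rewrite /u exprnP exprzAC -exprnP wN exp1rz.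
  move/eqP: (subrX1 u N); rewrite uN subrr eq_sym mulf_eq0 subr_eq0 (negPf u1).
  by move=> /eqP ->; rewrite mulr0.
pose b j := c j * a j; pose d j := if j == j0 then a j0 else 0.
have bd j : `|b j + - 1 * d j| <= `|outside m a j|.
  rewrite /b /d; have [->|jj0] := eqVneq j j0.
    by rewrite cj0 mul1r mulN1r subrr normr0.
  rewrite mulr0 addr0 /outside; case: ifPn => [jm|_]; last first.
    by rewrite normrM ler_piMl.
  rewrite c_eq0 // ?mul0r ?normr0 //.
  have lem : (`|j| <= m)%N by case: (j) jm => k //= /ltnW.
  have lem0 : (`|j0| <= m)%N by rewrite ltnW // leq_maxr.
  by rewrite ltnS (leq_trans (leqD_dist j 0 j0)) // subr0 sub0r abszN leq_add.
have [n0 Hn0] := cb.2 e e_gt0.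
pose n := maxn m n0.
have /Hn0 : (n0 <= n)%N by apply: leq_maxr.
rewrite sub0r normrN => bn.
(* [n] is past [j0], past the window [m], and past the point where the partial
   sums of [b] are small. *)
have dn : wsum d n = a j0.
  by apply: wsum_pick; rewrite leq_max leq_maxr.
have : `|wsum b n + - 1 * wsum d n| <= e.
  rewrite -wsumZ -wsumD; apply: le_trans (norm_wsum _ _) _.
  apply: le_trans (le_wsum _ bd) _.
  have -> : (fun j => `|outside m a j|) = outside m (fun j => `|a j|).
    by apply/funext => j; rewrite /outside; case: ifP; rewrite ?normr0.
  rewrite wsum_outside ?leq_maxl // ltW //.
  by apply: tail; rewrite ?leq_maxl.
rewrite dn mulN1r => abn.
rewrite -[a j0](subrK (wsum b n)) (le_trans (ler_normD _ _)) //.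
by rewrite lerD ?(ltW bn) // distrC.
Qed.

End Uniqueness.

(** * Laurent expansion of rational functions *)

Section Laurent.
Variable R : realType.
Local Notation C := R[i].
Implicit Types (a b : int -> C) (p : {poly C}).

(** The constant [B / (tau - |c|)] is the fixed point of the recursion that the
    bound on [x n / tau ^+ n] satisfies. *)
Lemma affine_rec_bound (c tau B : C) (y : nat -> C) :
  `|c| < tau -> (forall n, `|y n| <= B * tau ^+ n) ->
  exists x : nat -> C, [/\ x 0%N = 0, forall n, x n.+1 = c * x n + y n &
    forall n, `|x n| <= B / (tau - `|c|) * tau ^+ n].
Proof.
move=> lt_c y_le; pose x := fix x n := if n is k.+1 then c * x k + y k else 0.
have tc_gt0 : 0 < tau - `|c| by rewrite subr_gt0.
have tau_ge0 : 0 <= tau by rewrite (le_trans _ (ltW lt_c)).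
have B_ge0 : 0 <= B by have := le_trans (normr_ge0 _) (y_le 0%N); rewrite mulr1.
exists x; split=> //; elim=> [|n IH] /=.
  by rewrite normr0 mulr1 divr_ge0 // ltW.
apply: le_trans (ler_normD _ _) _; rewrite normrM.
apply: le_trans (lerD (ler_wpM2l (normr_ge0 c) IH) (y_le n)) _.
rewrite exprS !mulrA -mulrDl ler_wpM2r ?exprn_ge0 //.
have tc_neq0 := lt0r_neq0 tc_gt0.
rewrite le_eqVlt; apply/orP; left; apply/eqP.
by field.
Qed.

(** Coefficients of power series in [z], converging for [|z| < 1 / tau], and in
    [1 / z], converging for [|z| > tau]. *)
Definition right_decay (tau : C) a :=
  (forall n, a (Negz n) = 0) /\
  exists B, forall n, `|a (Posz n)| <= B * tau ^+ n.

Definition left_decay (tau : C) a :=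
  (forall n, a (Posz n.+1) = 0) /\
  exists B, forall n, `|a (- Posz n)| <= B * tau ^+ n.

(** Dividing by ['X - z0] is solved forward when [z0] is outside the circle of
    radius [1 / tau], and backward when it is inside the circle of radius
    [tau]; in both cases the recursion is contracting. *)
Lemma right_decay_div1 tau (z0 : C) a : `|z0^-1| < tau -> z0 != 0 ->
  right_decay tau a ->
  exists2 b, right_decay tau b & shift_act ('X - z0%:P) b =1 a.
Proof.
move=> lt_z z0_neq0 [a0 [B a_le]].
have [n|x [x0 xS x_le]] := @affine_rec_bound z0^-1 tau (`|z0^-1| * B)
    (fun n => - (z0^-1 * a (Posz n))) lt_z.
  by rewrite normrN normrM -mulrA ler_wpM2l.
exists (fun j => if j is Posz n then x n.+1 else 0).
  split=> //; exists (`|z0^-1| * B / (tau - `|z0^-1|) * tau) => n.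
  by apply: le_trans (x_le n.+1) _; rewrite exprS mulrA.
move=> j; rewrite shift_act_addl shift_actX -polyCN shift_actC.
case: j => [[|n]|n]; last 1 first.
- by rewrite a0 NegzE -opprD -PoszD addn1 -NegzE mulr0 addr0.
- by rewrite sub0r /= xS x0 mulr0 !add0r mulNr mulrN opprK mulrA divff // mul1r.
rewrite (_ : Posz n.+1 - 1 = Posz n); last by rewrite -addn1 PoszD addrK.
by rewrite [x n.+2]xS -mulrBr mulNr mulrA divff // mul1r opprB addrC subrK.
Qed.

Lemma left_decay_div1 tau (z0 : C) a : `|z0| < tau -> left_decay tau a ->
  exists2 b, left_decay tau b & shift_act ('X - z0%:P) b =1 a.
Proof.
move=> lt_z [a0 [B a_le]].
have [x [x0 xS x_le]] := @affine_rec_bound z0 tau B _ lt_z a_le.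
pose b (j : int) := if - j is Posz n then x n else 0.
have bP n : b (Posz n.+1) = 0 by rewrite /b -NegzE.
have bN n : b (- Posz n) = x n by rewrite /b opprK.
exists b; first by split=> //; exists (B / (tau - `|z0|)) => n; rewrite bN.
move=> j; rewrite shift_act_addl shift_actX -polyCN shift_actC.
have [[n ->]|[n ->]] : (exists n, j = - Posz n) \/ (exists n, j = Posz n.+1).
- case: j => [[|n]|n]; first by left; exists 0%N.
    by right; exists n.
  by left; exists n.+1.
- by rewrite -opprD -PoszD addn1 !bN xS mulNr addrAC subrr add0r.
rewrite (_ : Posz n.+1 - 1 = Posz n); last by rewrite -addn1 PoszD addrK.
rewrite bP mulr0 addr0 a0.
by case: n => [|n]; [have := bN 0%N; rewrite oppr0 x0|rewrite bP].
Qed.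

Lemma right_decay_div tau (s : seq C) a :
  (forall z, z \in s -> z != 0 /\ `|z^-1| < tau) -> right_decay tau a ->
  exists2 b, right_decay tau b & shift_act (\prod_(z <- s) ('X - z%:P)) b =1 a.
Proof.
elim: s a => [|z s IH] a sP aP.
  by exists a => // j; rewrite big_nil shift_act1.
have [z0 zt] := sP z (mem_head _ _).
have [b bP ab] := right_decay_div1 zt z0 aP.
have [|c cP bc] := IH b _ bP; first by move=> y ys; apply: sP; rewrite inE ys orbT.
exists c => // j; rewrite big_cons shift_actM -ab.
exact: eq_shift_act.
Qed.

Lemma left_decay_div tau (s : seq C) a :
  (forall z, z \in s -> `|z| < tau) -> left_decay tau a ->
  exists2 b, left_decay tau b & shift_act (\prod_(z <- s) ('X - z%:P)) b =1 a.
Proof.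
elim: s a => [|z s IH] a sP aP.
  by exists a => // j; rewrite big_nil shift_act1.
have [b bP ab] := left_decay_div1 (sP z (mem_head _ _)) aP.
have [|c cP bc] := IH b _ bP; first by move=> y ys; apply: sP; rewrite inE ys orbT.
exists c => // j; rewrite big_cons shift_actM -ab.
exact: eq_shift_act.
Qed.

Lemma finite_decay tau (x : nat -> C) N : 0 < tau ->
  (forall n, (N <= n)%N -> x n = 0) ->
  exists B, forall n, `|x n| <= B * tau ^+ n.
Proof.
move=> tau_gt0 xN; exists (\sum_(k < N) `|x k| / tau ^+ k) => n.
have [/xN ->|lt_nN] := leqP N n.
  rewrite normr0 mulr_ge0 ?exprn_ge0 ?(ltW tau_gt0) //; apply: sumr_ge0 => k _.
  by rewrite divr_ge0 ?exprn_ge0 ?(ltW tau_gt0).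
rewrite -ler_pdivrMr ?exprn_gt0 // (bigD1 (Ordinal lt_nN)) //= lerDl.
by apply: sumr_ge0 => k _; rewrite divr_ge0 ?exprn_ge0 ?(ltW tau_gt0).
Qed.

Lemma geometric_le (q : C) n : 0 <= q -> q < 1 ->
  \sum_(k < n) q ^+ k <= (1 - q)^-1.
Proof.
move=> q_ge0 q_lt1; have q1 : 0 < 1 - q by rewrite subr_gt0.
rewrite -[leRHS]mul1r ler_pdivlMr // mulrC -[X in X <= _]opprK -mulNr opprB.
by rewrite -subrX1 opprB gerDl oppr_le0 exprn_ge0.
Qed.

Lemma right_decay_summable tau (z : C) a : 0 < tau -> `|z| < tau^-1 ->
  right_decay tau a -> summableZ (fun j => z ^ j * a j).
Proof.
move=> tau_gt0 lt_z [a0 [B a_le]].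
have q1 : tau * `|z| < 1 by rewrite mulrC -ltr_pdivlMr ?div1r.
exists (B * (1 - tau * `|z|)^-1) => n.
apply: le_trans (_ : B * \sum_(k < n) (tau * `|z|) ^+ k <= _).
  rewrite /wsum big_distrr; apply: ler_sum => k _ /=.
  rewrite a0 mulr0 normr0 addr0 normrM normrX exprMn mulrA [leRHS]mulrC.
  exact: ler_wpM2l.
have B_ge0 : 0 <= B by have := le_trans (normr_ge0 _) (a_le 0%N); rewrite mulr1.
by apply: ler_wpM2l => //; apply: geometric_le; rewrite ?mulr_ge0 ?(ltW tau_gt0).
Qed.

Lemma left_decay_summable tau (z : C) a : 0 < tau -> tau < `|z| ->
  left_decay tau a -> summableZ (fun j => z ^ j * a j).
Proof.
move=> tau_gt0 lt_z [a0 [B a_le]].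
have z_gt0 : 0 < `|z| by apply: lt_trans lt_z.
have q1 : tau / `|z| < 1 by rewrite ltr_pdivrMr ?mul1r.
have B_ge0 : 0 <= B by have := le_trans (normr_ge0 _) (a_le 0%N); rewrite mulr1.
exists (B * (1 - tau / `|z|)^-1) => n.
apply: le_trans (_ : B * \sum_(k < n.+1) (tau / `|z|) ^+ k <= _); last first.
  by apply: ler_wpM2l => //; apply: geometric_le; rewrite ?divr_ge0 ?ltW.
have term k : `|z ^ (- Posz k) * a (- Posz k)| <= B * (tau / `|z|) ^+ k.
  rewrite normrM -invr_expz -exprnP normfV normrX exprMn exprVn mulrA [leRHS]mulrC.
  by apply: ler_wpM2l; rewrite ?invr_ge0 ?exprn_ge0.
case: n => [|n].
  rewrite /wsum big_ord0 mulr_ge0 //; apply: sumr_ge0 => k _.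
  by rewrite exprn_ge0 // divr_ge0 ?ltW.
rewrite /wsum big_split /= big_ord_recl big1 => [|k _]; last first.
  by rewrite a0 mulr0 normr0.
rewrite addr0 [leRHS]big_distrr [leRHS]big_ord_recl /=; apply: lerD.
  by have := term 0%N; rewrite oppr0.
by apply: ler_sum => k _; exact: (term k.+1).
Qed.

(** By induction on the list, replacing the distances [1 - t] and [1 - r] to the
    circle by their product. *)
Lemma roots_off_circle (s : seq C) : (forall z, z \in s -> `|z| != 1) ->
  exists tau : R, [/\ 0 < tau, tau < 1 & forall z, z \in s ->
    `|z| < tau%:C \/ (z != 0 /\ `|z^-1| < tau%:C)].
Proof.
elim: s => [|z s IH] sP.
  by exists 2^-1; split=> //; rewrite ?invr_gt0 ?ltr0n // invf_lt1 ?ltr1n.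
have [|t [t_gt0 t_lt1 tP]] := IH.
  by move=> y ys; apply: sP; rewrite inE ys orbT.
have [y [y1 yP]] : exists y : C, `|y| < 1 /\ (y = z \/ (z != 0 /\ y = z^-1)).
  have [z1|z1|/eqP] := real_ltgtP (normr_real z) (real1 C).
  - by exists z; split=> //; left.
  - exists z^-1; split; last first.
      by right; rewrite -normr_gt0 (lt_trans ltr01).
    by rewrite normfV invf_lt1 // (lt_trans ltr01).
  - by rewrite (negPf (sP z (mem_head _ _))).
have yE : `|y| = (complex.Re `|y|)%:C by rewrite RRe_real // ger0_real.
set r := complex.Re `|y| in yE.
have r_ge0 : 0 <= r by rewrite -ler0c -yE.
have r_lt1 : r < 1 by rewrite -ltcR -yE.
have lt1 : (1 - t) * (1 - r) > 0 by rewrite mulr_gt0 ?subr_gt0.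
exists (1 - (1 - t) * (1 - r)).
have le_t : t <= 1 - (1 - t) * (1 - r).
  by rewrite lerBrDr -lerBrDl ler_piMr ?subr_ge0 ?(ltW t_lt1) // gerBl.
have lt_r : r < 1 - (1 - t) * (1 - r).
  rewrite ltrBrDr -ltrBrDl gtr_pMl ?subr_gt0 //.
  by rewrite gtrBl.
split; [exact: lt_le_trans le_t | by rewrite gtrBl |].
move=> u; rewrite inE => /orP[/eqP ->|us].
  have : `|y| < (1 - (1 - t) * (1 - r))%:C by rewrite yE ltcR.
  by case: yP => [->|[? ->]]; [left|right].
by have [h|[? h]] := tP u us; [left|right; split=> //];
  apply: lt_le_trans h _; rewrite lecR.
Qed.

(** The Laurent expansion near the unit circle of a rational function
    [num / den] without poles on the circle, described by its coefficients:
    Bezout splits it into a part with poles outside, which is a power series in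
    [z], and a part with poles inside, which is a power series in [1 / z]. *)
Lemma laurent_rational (num den : {poly C}) : den != 0 ->
  (forall z, `|z| = 1 -> ~~ root den z) ->
  exists (n : nat) (a : int -> C), shift_act den a =1 coef_int num /\
    forall z, 1 - n.+1%:R^-1 < `|z| < 1 + n.+1%:R^-1 ->
      den.[z] != 0 /\ summableZ (fun j => z ^ j * a j).
Proof.
move=> den0 den1; have [s sE] := closed_field_poly_normal den.
set c := lead_coef den in sE.
have c0 : c != 0 by rewrite lead_coef_eq0.
have rootE z : root den z = (z \in s).
  by rewrite sE rootZ // root_prod_XsubC.
have [|tau [tau_gt0 tau_lt1 tauP]] := @roots_off_circle s.
  by move=> z; rewrite -rootE => zs; apply/eqP => /den1; rewrite zs.
have tau0 : 0 < tau%:C :> C by rewrite ltcR.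
pose small := [pred z : C | `|z| < tau%:C].
pose sA := [seq z <- s | ~~ small z]; pose sB := [seq z <- s | small z].
pose A := \prod_(z <- sA) ('X - z%:P); pose B := \prod_(z <- sB) ('X - z%:P).
have denE : den = c *: (A * B).
  by rewrite {1}sE; congr (_ *: _); rewrite (bigID small) mulrC /A /B !big_filter.
have sAP z : z \in sA -> z != 0 /\ `|z^-1| < tau%:C.
  by rewrite mem_filter /= => /andP[/negP zt] /tauP[].
have sBP z : z \in sB -> `|z| < tau%:C by rewrite mem_filter => /andP[].
have copAB : coprimep A B.
  apply: Pdiv.ClosedField.root_coprimep => z; rewrite /A root_prod_XsubC.
  rewrite mem_filter => /andP[/= zt _].
  by rewrite -[_ == 0]/(root B z) root_prod_XsubC mem_filter /= (negPf zt).
have /Bezout_eq1_coprimepP[[u v] /= uv] := copAB.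
have [a1 a1P a1E] : exists2 b, right_decay tau%:C b &
    shift_act A b =1 coef_int (c^-1 *: (num * v)).
  apply: right_decay_div => //; split=> //.
  apply: (@finite_decay _ (fun n => _`_n) (size (c^-1 *: (num * v)))) => //.
  by move=> n; apply: nth_default.
pose nu := c^-1 *: (num * u).
(* A left supported sequence cannot produce the coefficients of [nu] at positive
   indices, hence the shift by the size of [nu]. *)
have [a2 a2P a2E] : exists2 b, left_decay tau%:C b &
    shift_act B b =1 (fun j => coef_int nu (j + (size nu)%:Z)).
  apply: left_decay_div => //; split=> [n|].
    by rewrite -PoszD /= nth_default // leq_addl.
  apply: (@finite_decay _ (fun n => _) (size nu).+1) => // n lt_n.
  rewrite addrC -[_ - _]opprB subzn; last exact: ltnW.
  by case: (n - size nu)%N (subn_gt0 (size nu) n) => [|k]; rewrite ?lt_n // -NegzE.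
pose a j := a1 j + a2 (j - (size nu)%:Z).
have [n n_lt] : exists n : nat, n.+1%:R^-1 <= 1 - tau.
  have : 0 < 1 - tau by rewrite subr_gt0.
  by move=> /ltr_add_invr[n]; rewrite add0r => /ltW; exists n.
exists n, a; split=> [j|z /andP[lt1 lt2]].
  have coef_intD p r : coef_int p j + coef_int r j = coef_int (p + r) j.
    by case: (j) => k /=; rewrite ?coefD ?addr0.
  have h1 : shift_act den a1 j = coef_int (c *: B * (c^-1 *: (num * v))) j.
    rewrite denE scalerAr mulrC shift_actM (eq_shift_act _ _ a1E).
    by rewrite shift_act_coef_int.
  have h2 : shift_act den (fun u => a2 (u - (size nu)%:Z)) j =
            coef_int (c *: A * nu) j.
    rewrite shift_act_shift denE shift_actZl shift_actM.
    rewrite (eq_shift_act _ _ a2E).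
    have := shift_act_shift A (coef_int nu) (- (size nu)%:Z) (j - (size nu)%:Z).
    by rewrite opprK subrK => ->; rewrite -shift_actZl shift_act_coef_int.
  rewrite shift_act_addr h1 h2 coef_intD -!scalerAl -!scalerAr !scalerA divff //.
  rewrite !scale1r; congr (coef_int _ j).
  rewrite mulrCA [A * _]mulrCA -mulrDr [B * v]mulrC [A * u]mulrC addrC uv.
  exact: mulr1.
have nC : (n.+1%:R^-1 : C) = (n.+1%:R^-1)%:C.
  by rewrite rmorphV ?unitfE ?pnatr_eq0 //= rmorph_nat.
have ltz1 : tau%:C < `|z|.
  apply: le_lt_trans lt1; rewrite nC -[1 - _]rmorphB lecR.
  by rewrite lerBrDr -lerBrDl.
have ltz2 : `|z| < (tau%:C)^-1.
  apply: lt_le_trans lt2 _; rewrite -fmorphV nC -rmorphD lecR.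
  apply: le_trans (lerD (lexx 1) n_lt) _.
  rewrite -[leRHS]mul1r ler_pdivlMr //; nra.
have z_gt0 : 0 < `|z| by apply: lt_trans ltz1.
have z0 : z != 0 by rewrite -normr_gt0.
split.
  apply/negP; rewrite -[_ == 0]/(root den z) rootE => /tauP[|[_]].
    by move=> /(lt_trans ltz1); rewrite ltxx.
  rewrite normfV invf_plt ?posrE // => /(lt_trans ltz2).
  by rewrite ltxx.
apply: le_summableZ (_ : summableZ (fun j => z ^ j * a1 j +
    z ^ (size nu)%:Z * (z ^ (j - (size nu)%:Z) * a2 (j - (size nu)%:Z)))) => [j|].
  have -> y : z ^ (size nu)%:Z * (z ^ (j - (size nu)%:Z) * y) = z ^ j * y.
    by rewrite mulrA -expfzDr // addrC subrK.
  by rewrite -mulrDr.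
apply: summableZD; first exact: right_decay_summable a1P.
apply: summableZZ.
have [S S2] := summableZ_sums (left_decay_summable tau0 ltz1 a2P).
by have [] := sumsZ_shift (size nu) S2.
Qed.

(** The action of the backshift on the coefficients is multiplication of the
    sum of the series: take [z ^ (- t)] as the input of the filter. *)
Lemma laurent_eval (p : {poly C}) a (z S : C) : z != 0 ->
  sumsZ (fun j => z ^ j * a j) S ->
  sumsZ (fun j => z ^ j * shift_act p a j) (p.[z] * S).
Proof.
move=> z0 aS.
have := @sumsZ_shift_act _ p a (fun t => z ^ (- t)) (fun t => z ^ (- t) * S) 0.
have -> : shift_act p (fun t => z ^ (- t) * S) 0 = p.[z] * S.
  rewrite horner_coef mulr_suml; apply: eq_bigr => k _.
  by rewrite sub0r opprK -exprnP mulrA.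
move=> h; apply: eq_sumsZ (h _) => [j|t]; first by rewrite sub0r opprK mulrC.
apply: eq_sumsZ (sumsZZ (z ^ (- t)) aS) => j.
by rewrite opprB expfzDr // mulrA mulrC [z ^ (- t) * _]mulrC.
Qed.

Lemma laurent_poly (p : {poly C}) (z : C) :
  sumsZ (fun j => z ^ j * coef_int p j) p.[z].
Proof.
have := @sumsZ_coef_int _ p (fun t => z ^ (- t)) 0.
have -> : shift_act p (fun t => z ^ (- t)) 0 = p.[z].
  by rewrite horner_coef; apply: eq_bigr => k _; rewrite sub0r opprK -exprnP.
by apply: eq_sumsZ => j; rewrite sub0r opprK mulrC.
Qed.

End Laurent.

(** * Removable singularities of rational functions *)

Section Removable.
Variable K : numFieldType.
Implicit Types (p q : {poly K}) (f g : K -> K).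

Lemma poly_derivable p (x : K) : derivable (fun z => p.[z]) x 1.
Proof.
elim/poly_ind: p => [|p c IH].
  by under eq_fun do rewrite horner0; exact: derivable_cst.
under eq_fun do rewrite hornerMXaddC.
apply: (@derivableD _ _ _ (fun z => p.[z] * z) (fun=> c)).
  by apply: (@derivableM _ _ (fun z => p.[z]) id) => //; exact: derivable_id.
exact: derivable_cst.
Qed.

Lemma derivable1_cvg f (x : K) : derivable f x 1 -> f @ x --> f x.
Proof. by move=> /derivable1_diffP/differentiable_continuous. Qed.

Lemma poly_cvg p (x : K) : (fun z => p.[z]) @ x --> p.[x].
Proof. by apply: derivable1_cvg; exact: poly_derivable. Qed.

Lemma poly_near_neq0 p (x : K) : p.[x] != 0 -> \forall z \near x, p.[z] != 0.
Proof.
move=> px0; have /cvgrPdist_lt /(_ `|p.[x]|) := @poly_cvg p x.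
rewrite normr_gt0 => /(_ px0); apply: filterS => z.
by apply: contraTneq => ->; rewrite subr0 ltxx.
Qed.

Lemma poly_near_neq0' p (x : K) : p != 0 -> \forall z \near x^', p.[z] != 0.
Proof.
move=> p0; have [n [q]] := multiplicity_XsubC p x; rewrite p0 /= => qx ->.
have /poly_near_neq0 q0 : q.[x] != 0 by [].
apply: filterS2 (nbhs_dnbhs q0) (nbhs_dnbhs_neq x) => z qz zx.
by rewrite hornerM mulf_neq0 // horner_exp expf_neq0 // hornerXsubC subr_eq0.
Qed.

(** If [g] extends the fraction [num / den] in lowest terms continuously to [x],
    then [num.[x] = den.[x] * g x]; since [num] and [den] have no common root,
    [den] does not vanish at [x]. Conversely [num / den] is itself the
    extension. *)
Lemma removable_fraction f (h delta : {poly K}) (x : K) : delta != 0 ->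
  (forall z, delta.[z] != 0 -> f z = h.[z] / delta.[z]) ->
  removable_singularity f x <->
  (delta %/ gcdp h delta).[x] != 0.
Proof.
move=> delta0 fE; set G := gcdp h delta; set num := h %/ G; set den := delta %/ G.
have hE : h = num * G by rewrite divpK // dvdp_gcdl.
have dE : delta = den * G by rewrite divpK // dvdp_gcdr.
have cop : coprimep num den.
  by apply: coprimep_div_gcd; rewrite delta0 orbT.
have fE' z : delta.[z] != 0 -> den.[z] != 0 /\ f z = num.[z] / den.[z].
  move=> dz; move: (dz); rewrite dE hornerM mulf_eq0 negb_or => /andP[dz0 Gz0].
  by split=> //; rewrite fE // hE dE !hornerM -mulf_div divff // mulr1.
split=> [[g [g_der fg]]|den_x].
  have g_cvg : g @ x --> g x by apply: derivable1_cvg; exact: nbhs_singleton g_der.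
  apply/negP => /eqP den_x0.
  have at_x : (fun z => den.[z] * g z - num.[z]) @ x -->
              den.[x] * g x - num.[x].
    have den_cvg := @poly_cvg den x; have num_cvg := @poly_cvg num x.
    exact: (cvgB (cvgM den_cvg g_cvg) num_cvg).
  have : (fun z => den.[z] * g z - num.[z]) @ x^' --> den.[x] * g x - num.[x].
    by apply: cvg_trans at_x; apply: cvg_app; exact: nbhs_dnbhs.
  have zero : (fun z => den.[z] * g z - num.[z]) @ x^' --> (0 : K).
    apply: cvg_near_cst; apply: filterS2 fg (poly_near_neq0' x delta0) => z <- dz.
    by have [dz0 ->] := fE' z dz; rewrite mulrCA divff // mulr1 subrr.
  move=> /(cvg_unique (@norm_hausdorff _ _) zero)/esym/eqP.
  rewrite den_x0 mul0r sub0r oppr_eq0 => num_x0.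
  by have := coprimep_root cop num_x0; rewrite den_x0 eqxx.
exists (fun z => num.[z] / den.[z]); split.
  apply: filterS (poly_near_neq0 den_x) => z dz.
  apply: (@derivableM _ _ (fun z => num.[z]) (fun z => den.[z]^-1)).
    exact: poly_derivable.
  by apply: derivableV => //; exact: poly_derivable.
by apply: filterS (poly_near_neq0' x delta0) => z /fE'[_].
Qed.

End Removable.

(** * Square-integrable complex random variables *)

Section SquareIntegrable.
(* The notation for conjugation is the one of [ring_scope], which [_ ^t*]
   uses as well. *)
Local Open Scope ring_scope.
Context {disp : measure_display} {T : measurableType disp} {R : realType}.
Variable Pr : probability T R.
Local Notation C := R[i].
Local Notation cE := (cexpectation Pr).
Implicit Types (X Y : T -> C) (f g : T -> R).

(** The squared modulus as a real number, in the form in which second moments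
    of random vectors are defined. *)
Definition normsq (z : C) : R := complex.Re z ^+ 2 + complex.Im z ^+ 2.

Definition cmeasurable X :=
  measurable_fun setT (fun w => complex.Re (X w)) /\
  measurable_fun setT (fun w => complex.Im (X w)).

Definition rint f := Pr.-integrable setT (EFin \o f).

Definition cint X :=
  rint (fun w => complex.Re (X w)) /\ rint (fun w => complex.Im (X w)).

Definition csqint X := cmeasurable X /\ rint (fun w => normsq (X w)).

Lemma normsq_ge0 z : 0 <= normsq z.
Proof. by rewrite addr_ge0 ?sqr_ge0. Qed.

Lemma normsqE z : (normsq z)%:C = `|z| ^+ 2.
Proof. exact: add_Re2_Im2. Qed.

Lemma normsqM z z' : normsq (z * z') = normsq z * normsq z'.
Proof. by apply: complexI; rewrite rmorphM /= !normsqE normrM exprMn. Qed.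

Lemma normsq_mulJ z : z * z^* = (normsq z)%:C.
Proof. by rewrite normsqE normCK. Qed.

Lemma normsqD_le z z' : normsq (z + z') <= 2 * normsq z + 2 * normsq z'.
Proof.
case: z z' => a b [c d]; rewrite /normsq /= -subr_ge0.
have -> : 2 * (a ^+ 2 + b ^+ 2) + 2 * (c ^+ 2 + d ^+ 2) -
  ((a + c) ^+ 2 + (b + d) ^+ 2) = (a - c) ^+ 2 + (b - d) ^+ 2 by ring.
by rewrite addr_ge0 ?sqr_ge0.
Qed.

Lemma Re_mulJ (z z' : C) : complex.Re (z * z'^*) =
  complex.Re z * complex.Re z' + complex.Im z * complex.Im z'.
Proof. by case: z z' => a b [c d] /=; rewrite mulrN opprK. Qed.

Lemma Im_mulJ (z z' : C) : complex.Im (z * z'^*) =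
  complex.Im z * complex.Re z' - complex.Re z * complex.Im z'.
Proof. by case: z z' => a b [c d] /=; rewrite mulrN addrC. Qed.

Lemma ReIm_mulJ_le (z z' : C) :
  `|complex.Re (z * z'^*)| <= normsq z + normsq z' /\
  `|complex.Im (z * z'^*)| <= normsq z + normsq z'.
Proof.
rewrite Re_mulJ Im_mulJ; case: z z' => a b [c d]; rewrite /normsq /=.
have := (sqr_ge0 (a - c), sqr_ge0 (b - d), sqr_ge0 (a + c), sqr_ge0 (b + d)).
have := (sqr_ge0 (b - c), sqr_ge0 (a - d), sqr_ge0 (b + c), sqr_ge0 (a + d)).
move=> [[[h1 h2] h3] h4] [[[h5 h6] h7] h8].
by split; rewrite ler_norml; apply/andP; split; nra.
Qed.

Lemma cexpectationE X : cE X = (\int[Pr]_w complex.Re (X w))%R +i*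
  (\int[Pr]_w complex.Im (X w))%R.
Proof. by rewrite /cexpectation unlock. Qed.

Lemma rintD f g : rint f -> rint g -> rint (fun w => f w + g w).
Proof. by move=> fi gi; have := integrableD measurableT fi gi. Qed.

Lemma rintZ (k : R) f : rint f -> rint (fun w => k * f w).
Proof. by move=> fi; have := integrableZl measurableT k fi. Qed.

Lemma rint_cst (k : R) : rint (fun=> k).
Proof. exact: finite_measure_integrable_cst. Qed.

Lemma le_rint f g : measurable_fun setT f -> (forall w, `|f w| <= g w) ->
  rint g -> rint f.
Proof.
move=> mf fg; apply: le_integrable => //; first exact/measurable_EFinP.
by move=> w _ /=; rewrite lee_fin (le_trans (fg w)) // ler_norm.
Qed.

Lemma rint_measurable f : rint f -> measurable_fun setT f.
Proof. by move=> /integrableP[/measurable_EFinP]. Qed.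

Lemma cintD X Y : cint X -> cint Y -> cint (fun w => X w + Y w).
Proof.
move=> [X1 X2] [Y1 Y2]; split; under eq_fun do rewrite raddfD; exact: rintD.
Qed.

Lemma Re_mul (z z' : C) : complex.Re (z * z') =
  complex.Re z * complex.Re z' + - complex.Im z * complex.Im z'.
Proof. by case: z z' => a b [c d] /=; rewrite mulNr. Qed.

Lemma Im_mul (z z' : C) : complex.Im (z * z') =
  complex.Im z * complex.Re z' + complex.Re z * complex.Im z'.
Proof. by case: z z' => a b [c d] /=; rewrite addrC. Qed.

Lemma cintZ (k : C) X : cint X -> cint (fun w => k * X w).
Proof.
move=> [X1 X2]; split.
  by under eq_fun do rewrite Re_mul; apply: rintD; apply: rintZ.
by under eq_fun do rewrite Im_mul; apply: rintD; apply: rintZ.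
Qed.

Lemma cint_cst (k : C) : cint (fun=> k).
Proof. by split; exact: rint_cst. Qed.

Lemma cint_sum (I : Type) (r : seq I) (P : pred I) (X : I -> T -> C) :
  (forall i, P i -> cint (X i)) -> cint (fun w => \sum_(i <- r | P i) X i w).
Proof.
move=> Xi; elim: r => [|i r IH].
  by under eq_fun do rewrite big_nil; exact: cint_cst.
have [Pi|/negbTE Pi] := boolP (P i); under eq_fun do rewrite big_cons Pi; last by [].
exact: cintD (Xi i Pi) IH.
Qed.

Lemma cexpectationD X Y : cint X -> cint Y ->
  cE (fun w => X w + Y w) = cE X + cE Y.
Proof.
move=> [X1 X2] [Y1 Y2]; rewrite !cexpectationE.
have -> : (fun w => complex.Re (X w + Y w)) =
    (fun w => complex.Re (X w) + complex.Re (Y w)).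
  by apply/funext => w; rewrite raddfD.
have -> : (fun w => complex.Im (X w + Y w)) =
    (fun w => complex.Im (X w) + complex.Im (Y w)).
  by apply/funext => w; rewrite raddfD.
by rewrite !RintegralD.
Qed.

Lemma cexpectationZ (k : C) X : cint X -> cE (fun w => k * X w) = k * cE X.
Proof.
move=> [X1 X2]; rewrite !cexpectationE.
have -> : (fun w => complex.Re (k * X w)) = (fun w =>
    complex.Re k * complex.Re (X w) + - complex.Im k * complex.Im (X w)).
  by apply/funext => w; rewrite Re_mul.
have -> : (fun w => complex.Im (k * X w)) = (fun w =>
    complex.Im k * complex.Re (X w) + complex.Re k * complex.Im (X w)).
  by apply/funext => w; rewrite Im_mul.
rewrite !RintegralD ?RintegralZl //; do ?exact: rintZ.
by apply/eqP; rewrite eq_complex Re_mul Im_mul /= !eqxx.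
Qed.

Lemma cexpectation_cst (k : C) : cE (fun=> k) = k.
Proof.
rewrite cexpectationE !Rintegral_cst //= probability_setT /= !mulr1.
by case: k.
Qed.

Lemma cexpectation_sum (I : Type) (r : seq I) (P : pred I) (X : I -> T -> C) :
  (forall i, P i -> cint (X i)) ->
  cE (fun w => \sum_(i <- r | P i) X i w) = \sum_(i <- r | P i) cE (X i).
Proof.
move=> Xi; elim: r => [|i r IH].
  by under eq_fun do rewrite big_nil; rewrite cexpectation_cst big_nil.
rewrite big_cons; have [Pi|/negbTE Pi] := boolP (P i);
  under eq_fun do rewrite big_cons Pi; last by [].
rewrite cexpectationD ?IH //; [exact: Xi|exact: cint_sum].
Qed.

Lemma cexpectation_ae_eq X Y : cmeasurable X -> cmeasurable Y ->
  {ae Pr, forall w, X w = Y w} -> cE X = cE Y.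
Proof.
move=> [X1 X2] [Y1 Y2] XY; rewrite !cexpectationE /Rintegral.
congr (fine _ +i* fine _); apply: ae_eq_integral => //;
  do ?exact/measurable_EFinP;
  by apply: filterS XY => w XYw _; rewrite /= XYw.
Qed.

Lemma cmeasurableD X Y : cmeasurable X -> cmeasurable Y ->
  cmeasurable (fun w => X w + Y w).
Proof.
move=> [X1 X2] [Y1 Y2]; split; under eq_fun do rewrite raddfD;
  exact: measurable_funD.
Qed.

Lemma cmeasurableM X Y : cmeasurable X -> cmeasurable Y ->
  cmeasurable (fun w => X w * Y w).
Proof.
move=> [X1 X2] [Y1 Y2]; split.
  under eq_fun do rewrite Re_mul mulNr.
  by apply: measurable_funB; apply: measurable_funM.
under eq_fun do rewrite Im_mul.
by apply: measurable_funD; apply: measurable_funM.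
Qed.

Lemma cmeasurable_cst (k : C) : cmeasurable (fun=> k).
Proof. by split; exact: measurable_cst. Qed.

Lemma cmeasurable_sum (I : Type) (r : seq I) (P : pred I) (X : I -> T -> C) :
  (forall i, P i -> cmeasurable (X i)) ->
  cmeasurable (fun w => \sum_(i <- r | P i) X i w).
Proof.
move=> Xi; elim: r => [|i r IH].
  by under eq_fun do rewrite big_nil; exact: cmeasurable_cst.
have [Pi|/negbTE Pi] := boolP (P i); under eq_fun do rewrite big_cons Pi; last by [].
exact: cmeasurableD (Xi i Pi) IH.
Qed.

Lemma cmeasurableJ X : cmeasurable X -> cmeasurable (fun w => (X w)^*).
Proof.
move=> [X1 X2]; split.
  by rewrite (_ : (fun w => _) = (fun w => complex.Re (X w))) //;
     apply/funext => w; case: (X w).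
rewrite (_ : (fun w => _) = (fun w => - complex.Im (X w))).
  exact: measurable_funN.
by apply/funext => w; case: (X w).
Qed.

Lemma cmeasurable_normsq X : cmeasurable X ->
  measurable_fun setT (fun w => normsq (X w)).
Proof.
by move=> [X1 X2]; apply: measurable_funD; apply: measurable_funX.
Qed.

Lemma le_csqint X f : cmeasurable X -> (forall w, normsq (X w) <= f w) ->
  rint f -> csqint X.
Proof.
move=> Xm Xf fi; split=> //; apply: le_rint fi; first exact: cmeasurable_normsq.
by move=> w; rewrite ger0_norm ?normsq_ge0.
Qed.

Lemma csqintD X Y : csqint X -> csqint Y -> csqint (fun w => X w + Y w).
Proof.
move=> [Xm Xi] [Ym Yi].
apply: (@le_csqint _ (fun w => 2 * normsq (X w) + 2 * normsq (Y w))).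
- exact: cmeasurableD.
- by move=> w; exact: normsqD_le.
- by apply: rintD; apply: rintZ.
Qed.

Lemma csqintZ (k : C) X : csqint X -> csqint (fun w => k * X w).
Proof.
move=> [Xm Xi]; split; first exact: cmeasurableM (cmeasurable_cst k) Xm.
by under eq_fun do rewrite normsqM; exact: rintZ.
Qed.

Lemma csqint_cst (k : C) : csqint (fun=> k).
Proof. by split; [exact: cmeasurable_cst | exact: rint_cst]. Qed.

Lemma csqint_sum (I : Type) (r : seq I) (P : pred I) (X : I -> T -> C) :
  (forall i, P i -> csqint (X i)) ->
  csqint (fun w => \sum_(i <- r | P i) X i w).
Proof.
move=> Xi; elim: r => [|i r IH].
  by under eq_fun do rewrite big_nil; exact: csqint_cst.
have [Pi|/negbTE Pi] := boolP (P i); under eq_fun do rewrite big_cons Pi; last by [].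
exact: csqintD (Xi i Pi) IH.
Qed.

Lemma csqint_cintM X Y : csqint X -> csqint Y -> cint (fun w => X w * (Y w)^*).
Proof.
move=> [Xm Xi] [Ym Yi].
have [m1 m2] := cmeasurableM Xm (cmeasurableJ Ym).
have bi := rintD Xi Yi.
by split; [apply: le_rint bi => // w; have [] := ReIm_mulJ_le (X w) (Y w)
          |apply: le_rint bi => // w; have [] := ReIm_mulJ_le (X w) (Y w)].
Qed.

Lemma csqint_cint X : csqint X -> cint X.
Proof.
move=> Xi; have := csqint_cintM Xi (csqint_cst 1).
by under eq_fun do rewrite conjC1 mulr1.
Qed.

(** The covariance form of centred variables. *)
Definition ip X Y : C := cE (fun w => X w * (Y w)^*).

Lemma ip_suml (I : Type) (r : seq I) (P : pred I) (a : I -> C)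
    (X : I -> T -> C) Y :
  (forall i, P i -> csqint (X i)) -> csqint Y ->
  ip (fun w => \sum_(i <- r | P i) a i * X i w) Y =
  \sum_(i <- r | P i) a i * ip (X i) Y.
Proof.
move=> Xi Yi; rewrite /ip.
under [X in cE X]eq_fun do rewrite mulr_suml.
rewrite cexpectation_sum => [|i Pi].
  apply: eq_bigr => i Pi; rewrite -cexpectationZ; last first.
    exact: csqint_cintM (Xi i Pi) Yi.
  by congr (cE _); apply/funext => w; rewrite mulrA.
by apply: csqint_cintM Yi; exact: csqintZ (Xi i Pi).
Qed.

Lemma ip_sumr (I : Type) (r : seq I) (P : pred I) (a : I -> C)
    X (Y : I -> T -> C) :
  csqint X -> (forall i, P i -> csqint (Y i)) ->
  ip X (fun w => \sum_(i <- r | P i) a i * Y i w) =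
  \sum_(i <- r | P i) (a i)^* * ip X (Y i).
Proof.
move=> Xi Yi; rewrite /ip.
under [X in cE X]eq_fun do rewrite rmorph_sum mulr_sumr.
rewrite cexpectation_sum => [|i Pi].
  apply: eq_bigr => i Pi; rewrite -cexpectationZ; last first.
    exact: csqint_cintM Xi (Yi i Pi).
  by congr (cE _); apply/funext => w; rewrite rmorphM mulrCA.
by apply: csqint_cintM Xi _; exact: csqintZ (Yi i Pi).
Qed.

Lemma ip_self X : ip X X = (\int[Pr]_w normsq (X w))%:C.
Proof.
rewrite /ip cexpectationE.
have -> : (fun w => complex.Re (X w * (X w)^*)) = (fun w => normsq (X w)).
  by apply/funext => w; rewrite normsq_mulJ.
have -> : (fun w => complex.Im (X w * (X w)^*)) = (fun=> 0).
  by apply/funext => w; rewrite normsq_mulJ.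
by rewrite Rintegral_cst // mul0r.
Qed.

Lemma m2_ae_eq X Y : cmeasurable X -> cmeasurable Y ->
  {ae Pr, forall w, X w = Y w} ->
  \int[Pr]_w normsq (X w) = \int[Pr]_w normsq (Y w).
Proof.
move=> Xm Ym XY; rewrite /Rintegral; congr fine; apply: ae_eq_integral => //;
  do ?[by apply/measurable_EFinP; exact: cmeasurable_normsq].
by apply: filterS XY => w XYw _; rewrite /= XYw.
Qed.

Lemma csqint_finite_second_moment X : csqint X <-> cmeasurable X /\
  (\int[Pr]_w (normsq (X w))%:E < +oo)%E.
Proof.
have absE : (fun w => `|(EFin \o (fun w => normsq (X w))) w|%E) =
            (fun w => (normsq (X w))%:E).
  by apply/funext => w; rewrite gee0_abs //= lee_fin normsq_ge0.
split=> [[Xm /integrableP[_ Xi]]|[Xm Xi]]; split=> //; first by rewrite -absE.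
apply/integrableP; split; first exact/measurable_EFinP/cmeasurable_normsq.
by rewrite absE.
Qed.

End SquareIntegrable.

(** * A pole on the unit circle is incompatible with bounded variance *)

Lemma weighted_cauchy_schwarz (F : realFieldType) (I : Type) (r : seq I)
    (c x : I -> F) : (forall i, 0 <= c i) ->
  (\sum_(i <- r) c i * x i) ^+ 2 <=
  (\sum_(i <- r) c i) * (\sum_(i <- r) c i * x i ^+ 2).
Proof.
move=> c_ge0; elim: r => [|i r IH]; first by rewrite !big_nil expr0n mulr0.
rewrite !big_cons.
set S := \sum_(j <- r) c j * x j in IH *; set A := \sum_(j <- r) c j in IH *.
set Q := \sum_(j <- r) c j * x j ^+ 2 in IH *.
have A_ge0 : 0 <= A by apply: sumr_ge0.
have Q_ge0 : 0 <= Q by apply: sumr_ge0 => j _; rewrite mulr_ge0 ?sqr_ge0.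
have key : 2 * S * x i <= A * x i ^+ 2 + Q.
  have [A0|A_neq0] := eqVneq A 0.
    have S0 : S = 0.
      by apply/eqP; rewrite -sqrf_eq0 eq_le sqr_ge0 andbT (le_trans IH) // A0 mul0r.
    by rewrite S0 A0 mulr0 !mul0r add0r.
  have A_gt0 : 0 < A by rewrite lt0r A_neq0.
  rewrite -subr_ge0 -(pmulr_rge0 _ A_gt0).
  apply: le_trans (_ : (A * x i - S) ^+ 2 <= _); first exact: sqr_ge0.
  rewrite -subr_ge0; have -> : A * (A * x i ^+ 2 + Q - 2 * S * x i) -
    (A * x i - S) ^+ 2 = A * Q - S ^+ 2 by ring.
  by rewrite subr_ge0.
have := ler_wpM2l (c_ge0 i) key; have := c_ge0 i; nra.
Qed.

Lemma sqr_sum_le (F : realFieldType) n (x : 'I_n -> F) :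
  (\sum_(i < n) x i) ^+ 2 <= n%:R * \sum_(i < n) x i ^+ 2.
Proof.
have := @weighted_cauchy_schwarz F _ (index_enum 'I_n) (fun=> 1) x (fun=> ler01).
under eq_bigr do rewrite mul1r.
under [X in _ <= _ * X -> _]eq_bigr do rewrite mul1r.
by rewrite sumr_const card_ord.
Qed.

Section GeometricPolynomial.
Variable K : idomainType.
Variable lambda : K.

(** The quotient of ['X^n - lambda^n] by ['X - lambda]. *)
Definition geom_poly n : {poly K} :=
  \sum_(i < n) 'X^(n.-1 - i) * lambda%:P ^+ i.

Lemma geom_polyE n : ('X - lambda%:P) * geom_poly n = 'X^n - (lambda ^+ n)%:P.
Proof. by rewrite -subrXX polyC_exp. Qed.

Lemma size_geom_poly n : (size (geom_poly n) <= n)%N.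
Proof.
apply: leq_trans (size_sum _ _ _) _; apply/bigmax_leqP => i _.
rewrite -polyC_exp mulrC mul_polyC (leq_trans (size_scale_leq _ _)) //.
by rewrite size_polyXn; case: n i => [[]//|n] i; rewrite ltnS leq_subr.
Qed.

Lemma horner_geom_poly n : (geom_poly n).[lambda] = lambda ^+ n.-1 *+ n.
Proof.
rewrite horner_sum (eq_bigr (fun=> lambda ^+ n.-1)); last first.
  move=> i _; rewrite -polyC_exp hornerM hornerC hornerXn -exprD subnK //.
  by case: n i => [[]//|n] i /=; rewrite -ltnS.
by rewrite sumr_const card_ord.
Qed.

(** Modulo ['X^N] the factor [('X^N - c) ^+ k] is the constant [(- c) ^+ k]. *)
Lemma coef_Xn_sub_exp N (c : K) k (f : {poly K}) j : (j < N)%N ->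
  (('X^N - c%:P) ^+ k * f)`_j = (- c) ^+ k * f`_j.
Proof.
move=> lt_jN; elim: k => [|k IH]; first by rewrite !expr0 !mul1r.
rewrite exprS -mulrA mulrBl coefB coefXnM lt_jN sub0r coefCM IH.
by rewrite exprS !mulNr mulrA.
Qed.

End GeometricPolynomial.

Section PoleFree.
Context {disp : measure_display} {T : measurableType disp} {R : realType}.
Variable Pr : probability T R.
Local Notation C := R[i].
Local Notation ip := (ip Pr).
Local Notation csqint := (csqint Pr).
Local Notation m2 X := (\int[Pr]_w normsq (X w))%R.
Implicit Types (x y : int -> T -> C).

Definition filter_process (p : {poly C}) x : int -> T -> C :=
  fun t w => shift_act p (fun u => x u w) t.

Definition bounded_process x (B : R) :=
  forall t, csqint (x t) /\ m2 (x t) <= B.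

Lemma m2D_le (X Y : T -> C) : csqint X -> csqint Y ->
  m2 (fun w => X w + Y w) <= 2 * m2 X + 2 * m2 Y.
Proof.
move=> Xi Yi; have [_ XYi] := csqintD Xi Yi.
have [[_ X1] [_ Y1]] := (Xi, Yi).
rewrite -!RintegralZl // -RintegralD //; do ?exact: rintZ.
apply: le_Rintegral => //; first by apply: rintD; exact: rintZ.
by move=> w _; exact: normsqD_le.
Qed.

Lemma m2Z (k : C) (X : T -> C) : csqint X ->
  m2 (fun w => k * X w) = normsq k * m2 X.
Proof.
move=> [_ Xi]; rewrite -RintegralZl //.
by apply: eq_Rintegral => w _; rewrite normsqM.
Qed.

Lemma bounded_filter p x B : bounded_process x B ->
  exists B', bounded_process (filter_process p x) B'.
Proof.
move=> xB; elim/poly_ind: p => [|p c [B' IH]].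
  exists 0 => t; have -> : filter_process 0 x t = fun=> 0.
    by apply/funext => w; exact: shift_act0l.
  split; first exact: csqint_cst.
  rewrite (_ : (fun w => _) = fun=> 0); first by rewrite Rintegral_cst // mul0r.
  by apply/funext => w; rewrite /normsq /= expr0n addr0.
exists (2 * B' + 2 * (normsq c * B)) => t.
have [IHi IHm] := IH (t - 1); have [xi xm] := xB t.
have -> : filter_process (p * 'X + c%:P) x t =
    fun w => filter_process p x (t - 1) w + c * x t w.
  apply/funext => w; rewrite /filter_process shift_act_addl shift_actC shift_actM.
  rewrite -(@shift_act_shift _ p (fun u => x u w)); congr (_ + _).
  by apply: eq_shift_act => u; rewrite shift_actX.
split; first by apply: csqintD => //; exact: csqintZ.
apply: le_trans (m2D_le IHi (csqintZ c xi)) _.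
rewrite m2Z //; have := normsq_ge0 c; nra.
Qed.

Lemma csqint_filter p x t : (forall t, csqint (x t)) ->
  csqint (filter_process p x t).
Proof.
by move=> xi; apply: csqint_sum => k _; apply: csqintZ.
Qed.

Lemma bounded_Xn_sub n (c : C) x B : normsq c = 1 -> bounded_process x B ->
  bounded_process (filter_process ('X^n - c%:P) x) (4 * B).
Proof.
move=> c1 xB t; have [xi xm] := xB t; have [xni xnm] := xB (t - n%:Z).
have -> : filter_process ('X^n - c%:P) x t = fun w => x (t - n%:Z) w + - c * x t w.
  apply/funext => w; rewrite /filter_process shift_act_addl shift_actXn.
  by rewrite -polyCN shift_actC.
split; first by apply: csqintD => //; exact: csqintZ.
apply: le_trans (m2D_le xni (csqintZ _ xi)) _.
rewrite m2Z // (_ : normsq (- c) = 1); first by lra.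
by apply: complexI; rewrite -c1 !normsqE normrN.
Qed.

Lemma filter_processM p q x :
  filter_process (p * q) x = filter_process p (filter_process q x).
Proof. by apply/funext => t; apply/funext => w; exact: shift_actM. Qed.

Lemma bounded_Xn_sub_exp n (c : C) k x B : normsq c = 1 -> bounded_process x B ->
  bounded_process (filter_process (('X^n - c%:P) ^+ k) x) (4 ^+ k * B).
Proof.
move=> c1 xB; elim: k => [|k IH].
  rewrite expr0 mul1r (_ : filter_process _ _ = x) //.
  by apply/funext => t; apply/funext => w; exact: shift_act1.
by rewrite exprS filter_processM exprS -mulrA; exact: bounded_Xn_sub.
Qed.

(** Pythagoras. *)
Lemma m2_orthogonal (J : finType) (a : J -> C) (V : J -> T -> C) (s : J -> R) :
  (forall i, csqint (V i)) ->
  (forall i j, ip (V i) (V j) = if i == j then (s i)%:C else 0) ->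
  m2 (fun w => \sum_i a i * V i w) = \sum_i normsq (a i) * s i.
Proof.
move=> Vi Vo; apply: complexI; rewrite -ip_self ip_suml //; last first.
  by apply: csqint_sum => i _; exact: csqintZ.
rewrite rmorph_sum; apply: eq_bigr => i _.
rewrite ip_sumr // (bigD1 i) //= big1 => [|j ji]; last first.
  by rewrite Vo eq_sym (negPf ji) mulr0.
by rewrite addr0 Vo eqxx mulrA normsq_mulJ rmorphM.
Qed.

(** One term of the variance of a sum of filtered noises; the other ones are
    nonnegative. *)
Lemma m2_filter_noise (I : finType) (W : I -> int -> T -> C) (sig : I -> R)
    (p : I -> {poly C}) t k N :
  (forall k t, csqint (W k t)) ->
  (forall k k' t t', ip (W k t) (W k' t') =
     if (k == k') && (t == t') then (sig k)%:C else 0) ->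
  (forall k, 0 <= sig k) ->
  sig k * \sum_(j < N) normsq (p k)`_j <=
  m2 (fun w => \sum_k filter_process (p k) (W k) t w).
Proof.
move=> Wi Wo sig_ge0.
pose L := (N + \max_k size (p k))%N.
pose a (x : I * 'I_L) := (p x.1)`_x.2.
pose V (x : I * 'I_L) := W x.1 (t - (x.2 : nat)%:Z).
have -> : (fun w => normsq (\sum_k filter_process (p k) (W k) t w)) =
          (fun w => normsq (\sum_x a x * V x w)).
  apply/funext => w; congr normsq.
  rewrite -(pair_bigA _ (fun i (j : 'I_L) =>
    (p i)`_j * W i (t - (j : nat)%:Z) w)) /=.
  apply: eq_bigr => i _; rewrite /filter_process (@shift_act_widen _ L) //.
  by apply: leq_trans (leq_addl N _); exact: (leq_bigmax (F := fun k => size (p k))).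
rewrite (m2_orthogonal a (V := V) (s := fun x : I * 'I_L => sig x.1))
  => [|x|x y]; last 2 first.
- exact: Wi.
- rewrite /V Wo -pair_eqE /pair_eq /=; congr (if _ && _ then _ else _).
  by rewrite (inj_eq (addrI _)) eqr_opp.
rewrite -(pair_bigA _ (fun i (j : 'I_L) => normsq (p i)`_j * sig i)) /=.
rewrite (bigD1 k) //=.
apply: le_trans (_ : \sum_(j < L) normsq (p k)`_j * sig k <= _).
  rewrite mulr_sumr.
  rewrite (big_ord_widen L (fun j => sig k * normsq (p k)`_j)) ?leq_addr //.
  rewrite big_mkcond; apply: ler_sum => j _; rewrite mulrC.
  by case: ifP => // _; rewrite mulr_ge0 ?normsq_ge0.
rewrite lerDl; apply: sumr_ge0 => i _; apply: sumr_ge0 => j _.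
by rewrite mulr_ge0 ?normsq_ge0.
Qed.

Lemma normsq_norm1 (z : C) : `|z| = 1 -> normsq z = 1.
Proof. by move=> z1; apply: complexI; rewrite normsqE z1 expr1n. Qed.

Lemma normsqX (z : C) n : normsq (z ^+ n) = normsq z ^+ n.
Proof. by apply: complexI; rewrite rmorphXn /= !normsqE normrX -!exprM mulnC. Qed.

Lemma normsq_horner_le (f : {poly C}) (z : C) N : `|z| = 1 ->
  (size f <= N)%N ->
  normsq f.[z] <= N%:R * \sum_(j < N) normsq f`_j.
Proof.
move=> z1 f_le; pose r (u : C) : R := complex.Re `|u|.
have rE u : (r u)%:C = `|u| by rewrite RRe_real // ger0_real.
have r2 u : normsq u = r u ^+ 2.
  by apply: complexI; rewrite normsqE rmorphXn /= rE.
under eq_bigr do rewrite r2.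
apply: le_trans (sqr_sum_le _); rewrite r2 lerXn2r ?nnegrE //.
- by rewrite -ler0c rE.
- by apply: sumr_ge0 => j _; rewrite -ler0c rE.
rewrite -lecR rE rmorph_sum (horner_coef_wide _ f_le).
apply: le_trans (ler_norm_sum _ _ _) _; apply: ler_sum => j _ /=.
by rewrite rE normrM normrX z1 expr1n mulr1.
Qed.

(** Let [delta(B) y = sum_k h_k(B) W_k] with [y] bounded in mean square and
    [W] white noise. Applying any polynomial [c] in the backshift and taking
    variances, the coefficients of [c h_k] are controlled by [c delta]. If
    [h_k / delta] had a pole at [lambda] on the unit circle, then the product
    [c] of [geom_poly lambda n] with a power of [geom_poly lambda N], [N] large,
    would turn the vanishing factors of [delta] into the bounded factors
    ['X^n - lambda^n] and ['X^N - lambda^N], while the variance of [c h_k]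
    grows like [n]. *)
Lemma pole_free (I : finType) (W : I -> int -> T -> C) (sig : I -> R)
    (h : I -> {poly C}) (delta : {poly C}) y B k (lambda : C) :
  (forall k t, csqint (W k t)) ->
  (forall k k' t t', ip (W k t) (W k' t') =
     if (k == k') && (t == t') then (sig k)%:C else 0) ->
  (forall k, 0 <= sig k) ->
  bounded_process y B ->
  {ae Pr, forall w t, filter_process delta y t w =
     \sum_k filter_process (h k) (W k) t w} ->
  delta != 0 -> 0 < sig k -> `|lambda| = 1 ->
  (delta %/ gcdp (h k) delta).[lambda] != 0.
Proof.
move=> Wi Wo sig_ge0 yB yW delta0 sigk lam1; apply/negP => /eqP den0.
set G := gcdp (h k) delta in den0.
have hE : h k = (h k %/ G) * G by rewrite divpK // dvdp_gcdl.
have dE : delta = (delta %/ G) * G by rewrite divpK // dvdp_gcdr.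
have cop : coprimep (h k %/ G) (delta %/ G).
  by apply: coprimep_div_gcd; rewrite delta0 orbT.
have num_neq0 : (h k %/ G).[lambda] != 0.
  have := coprimep_root (p := delta %/ G) (q := h k %/ G) (x := lambda).
  by rewrite coprimep_sym => /(_ cop); apply; apply/eqP.
have /factor_theorem[den' den'E] : root (delta %/ G) lambda by apply/eqP.
have [nu [G' /=]] := multiplicity_XsubC G lambda.
have G0 : G != 0 by rewrite gcdp_eq0 negb_and delta0 orbT.
rewrite G0 /= => G'lam GE.
pose h' := G' * (h k %/ G); pose delta' := den' * G'.
have h'E : h k = ('X - lambda%:P) ^+ nu * h'.
  by rewrite [LHS]hE [X in _ * X = _]GE /h'; ring.
have delta'E : delta = ('X - lambda%:P) ^+ nu.+1 * delta'.
  by rewrite [LHS]dE den'E [X in _ * X = _]GE /delta' exprS; ring.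
have h'lam : h'.[lambda] != 0 by rewrite hornerM mulf_neq0.
have [B' d'B] := bounded_filter delta' yB.
pose K : R := 4 ^+ nu.+1 * B'.
pose L : R := (size h')%:R.
have lamX n : normsq (lambda ^+ n) = 1 by rewrite normsqX normsq_norm1 // expr1n.
(* [n.+1] is the value of [geom_poly lambda n.+1] at [lambda] up to a factor of
   modulus [1], and [N] bounds the size of [f], so that the coefficients of [f]
   reappear in [c * h k] up to a factor of modulus [1]. *)
have main n : sig k * (n.+1%:R ^+ 2 * normsq h'.[lambda]) <= (n.+1%:R + L) * K.
  pose N := (n.+1 + size h')%N; pose f := geom_poly lambda n.+1 * h'.
  pose c := geom_poly lambda n.+1 * geom_poly lambda N ^+ nu.
  have fN : (size f <= N)%N.
    apply: leq_trans (size_polyMleq _ _) _; rewrite -subn1 leq_subLR.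
    apply: leq_trans (_ : n.+1 + size h' <= _)%N; last exact: leq_addl.
    by rewrite leq_add2r size_geom_poly.
  have cdE : c * delta = ('X^(n.+1) - (lambda ^+ n.+1)%:P) *
      (('X^N - (lambda ^+ N)%:P) ^+ nu * delta').
    by rewrite -!geom_polyE exprMn delta'E exprS /c; ring.
  have chE : c * h k = ('X^N - (lambda ^+ N)%:P) ^+ nu * f.
    by rewrite -geom_polyE exprMn h'E /c /f; ring.
  have le1 : m2 (filter_process (c * delta) y 0) <= K.
    have -> : K = 4 * (4 ^+ nu * B') by rewrite /K exprS mulrA.
    rewrite cdE filter_processM filter_processM.
    have yN := bounded_Xn_sub_exp N nu (lamX N) d'B.
    by have [] := bounded_Xn_sub n.+1 (lamX n.+1) yN 0.
  have ae1 : {ae Pr, forall w, filter_process (c * delta) y 0 w =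
      \sum_k filter_process (c * h k) (W k) 0 w}.
    apply: filterS yW => w yWw; rewrite filter_processM /filter_process.
    rewrite (eq_shift_act _ _ yWw) shift_act_sumr.
    by apply: eq_bigr => i _; exact/esym/shift_actM.
  have yi t : csqint (y t) by have [] := yB t.
  have le2 : sig k * \sum_(j < N) normsq f`_j <= K.
    apply: le_trans le1; rewrite (m2_ae_eq _ _ ae1); first last.
    - by apply: cmeasurable_sum => i _; have [] := csqint_filter (c * h i) 0 (Wi i).
    - by have [] := csqint_filter (c * delta) 0 yi.
    apply: le_trans (m2_filter_noise (fun i => c * h i) 0 k N Wi Wo sig_ge0).
    rewrite chE ler_wpM2l // le_eqVlt; apply/orP; left; apply/eqP.
    apply: eq_bigr => j _; rewrite coef_Xn_sub_exp // normsqM normsqX.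
    by rewrite (@normsq_norm1 (- _)) ?expr1n ?mul1r // normrN normrX lam1 expr1n.
  have le3 := normsq_horner_le lam1 fN.
  have flam : normsq f.[lambda] = n.+1%:R ^+ 2 * normsq h'.[lambda].
    rewrite hornerM horner_geom_poly -mulr_natl !normsqM lamX mulr1.
    congr (_ * _); rewrite -[n.+1%:R](rmorph_nat (real_complex R)).
    by rewrite /normsq /= expr0n addr0.
  rewrite -flam; apply: le_trans (ler_wpM2l (ltW sigk) le3) _.
  rewrite mulrCA /L -natrD; exact: ler_wpM2l.
have eta : 0 < sig k * normsq h'.[lambda].
  rewrite mulr_gt0 // lt0r normsq_ge0 andbT; apply: contra h'lam.
  by move=> /eqP h0; rewrite -normr_eq0 -sqrf_eq0 -normsqE h0. 
have L_ge0 : 0 <= L by rewrite ler0n.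
have K_ge0 : 0 <= K.
  have := main 0%N; rewrite expr1n mul1r => /(lt_le_trans eta).
  by rewrite pmulr_rgt0 ?ltr_wpDr ?ltr01 // => /ltW.
set n := Num.bound ((1 + L) * K / (sig k * normsq h'.[lambda])).
have := archi_boundP (_ : 0 <= (1 + L) * K / (sig k * normsq h'.[lambda])).
rewrite -/n => /(_ (divr_ge0 (mulr_ge0 (addr_ge0 ler01 L_ge0) K_ge0) (ltW eta))).
rewrite ltr_pdivrMr // => n_lt; have := main n.
have n1 : (n%:R : R) + 1 = n.+1%:R by rewrite -natr1.
rewrite -n1; have n_ge0 : 0 <= (n%:R : R) by rewrite ler0n.
move: n_lt eta L_ge0 K_ge0 n_ge0.
set u := n%:R; set v := normsq _; set s := sig k.
move=> n_lt eta L_ge0 K_ge0 n_ge0 h1.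
have h2 : (u + 1 + L) * K <= (u + 1) * ((1 + L) * K).
  have : 0 <= u * (L * K) by apply: mulr_ge0 => //; apply: mulr_ge0.
  by nra.
have h3 : (u + 1) * ((1 + L) * K) < (u + 1) * ((u + 1) * (s * v)).
  rewrite ltr_pM2l ?ltr_wpDl //; apply: lt_trans n_lt _.
  by rewrite ltr_pM2r // ltrDl.
have : (u + 1) * ((u + 1) * (s * v)) <= (u + 1 + L) * K.
  by apply: le_trans h1; rewrite expr2; lra.
by move=> /(le_trans) /(_ h2) /(lt_le_trans h3); rewrite ltxx.
Qed.

End PoleFree.

(** * Two-sided filters of mean-square bounded processes *)

Section DominatedLimits.
Context {disp : measure_display} {T : measurableType disp} {R : realType}.
Variable Pr : probability T R.
Local Notation C := R[i].
Local Notation ip := (ip Pr).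
Local Notation csqint := (csqint Pr).
Local Notation m2 X := (\int[Pr]_w normsq (X w))%R.

Lemma Rintegral_dominated (f_ : nat -> T -> R) (f : T -> R) (H : T -> \bar R) :
  (forall n, measurable_fun setT (f_ n)) -> measurable_fun setT f ->
  {ae Pr, forall w, f_ ^~ w @ \oo --> f w} ->
  Pr.-integrable setT H -> (forall w n, (`|f_ n w|%:E <= H w)%E) ->
  rint Pr f /\ (\int[Pr]_w f_ n w)%R @[n --> \oo] --> (\int[Pr]_w f w)%R.
Proof.
move=> mf_ mf f_f Hi fH.
have [||||| fi _ fc] := @dominated_convergence _ _ _ Pr setT measurableT
    (fun n => EFin \o f_ n) (EFin \o f) H.
- by move=> n; exact/measurable_EFinP.
- exact/measurable_EFinP.
- by apply: filterS f_f => w fw _; apply: cvg_EFin => //; exact: nearW.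
- exact: Hi.
- by apply: nearW => w n _; exact: fH.
split=> //; apply: fine_cvg; rewrite fineK //.
exact: integrable_fin_num fi.
Qed.

Lemma conv_Re (u : nat -> C) l : conv u l ->
  (fun n => complex.Re (u n)) @ \oo --> complex.Re l.
Proof. by move=> /conv_ReIm[]. Qed.

Lemma conv_Im (u : nat -> C) l : conv u l ->
  (fun n => complex.Im (u n)) @ \oo --> complex.Im l.
Proof. by move=> /conv_ReIm[]. Qed.

Lemma convJ (u : nat -> C) l : conv u l ->
  conv (fun n => (u n)^*)%R (l^*)%R.
Proof.
move=> ul e /ul[N HN]; exists N => n /HN.
by rewrite -rmorphB norm_conjC.
Qed.

Lemma csqint_limit (X_ : nat -> T -> C) (X : T -> C) (H : T -> \bar R) :
  (forall n, cmeasurable (X_ n)) -> cmeasurable X ->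
  {ae Pr, forall w, conv (X_ ^~ w) (X w)} ->
  Pr.-integrable setT H -> (forall w n, ((normsq (X_ n w))%:E <= H w)%E) ->
  csqint X.
Proof.
move=> mX_ mX X_X Hi XH; split=> //.
have [] := @Rintegral_dominated (fun n w => normsq (X_ n w))
  (fun w => normsq (X w)) H => //.
- by move=> n; exact: cmeasurable_normsq.
- exact: cmeasurable_normsq.
- apply: filterS X_X => w Xw; rewrite /normsq.
  have Rw := conv_Re Xw; have Iw := conv_Im Xw.
  exact: (cvgD (cvgM Rw Rw) (cvgM Iw Iw)).
- by move=> w n; rewrite ger0_norm ?normsq_ge0.
Qed.

Lemma ip_limit (X_ Y_ : nat -> T -> C) (X Y : T -> C) (H H' : T -> \bar R) :
  (forall n, cmeasurable (X_ n)) -> cmeasurable X ->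
  (forall n, cmeasurable (Y_ n)) -> cmeasurable Y ->
  {ae Pr, forall w, conv (X_ ^~ w) (X w)} ->
  {ae Pr, forall w, conv (Y_ ^~ w) (Y w)} ->
  Pr.-integrable setT H -> (forall w n, ((normsq (X_ n w))%:E <= H w)%E) ->
  Pr.-integrable setT H' -> (forall w n, ((normsq (Y_ n w))%:E <= H' w)%E) ->
  conv (fun n => ip (X_ n) (Y_ n)) (ip X Y).
Proof.
move=> mX_ mX mY_ mY X_X Y_Y Hi XH H'i YH'.
have HHi : Pr.-integrable setT (H \+ H') by exact: integrableD.
have bound w n : ((normsq (X_ n w) + normsq (Y_ n w))%:E <= (H \+ H') w)%E.
  by rewrite EFinD leeD.
have mXY_ n := cmeasurableM (mX_ n) (cmeasurableJ (mY_ n)).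
have mXY := cmeasurableM mX (cmeasurableJ mY).
apply/conv_ReIm; split.
  have [|||||_] := @Rintegral_dominated
    (fun n w => complex.Re (X_ n w * (Y_ n w)^*)%R)
    (fun w => complex.Re (X w * (Y w)^*)%R) (H \+ H').
  - by move=> n; have [] := mXY_ n.
  - by have [] := mXY.
  - apply: filterS2 X_X Y_Y => w Xw Yw; exact: conv_Re (convM Xw (convJ Yw)).
  - exact: HHi.
  - move=> w n; apply: le_trans (bound w n); rewrite lee_fin.
    by have [] := ReIm_mulJ_le (X_ n w) (Y_ n w).
  - rewrite /ip /comp cexpectationE; apply: cvg_trans.
    by apply: near_eq_cvg; apply: nearW => n; rewrite cexpectationE.
have [|||||_] := @Rintegral_dominated
    (fun n w => complex.Im (X_ n w * (Y_ n w)^*)%R)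
    (fun w => complex.Im (X w * (Y w)^*)%R) (H \+ H').
- by move=> n; have [] := mXY_ n.
- by have [] := mXY.
- apply: filterS2 X_X Y_Y => w Xw Yw; exact: conv_Im (convM Xw (convJ Yw)).
- exact: HHi.
- move=> w n; apply: le_trans (bound w n); rewrite lee_fin.
  by have [] := ReIm_mulJ_le (X_ n w) (Y_ n w).
- rewrite /ip /comp cexpectationE; apply: cvg_trans.
  by apply: near_eq_cvg; apply: nearW => n; rewrite cexpectationE.
Qed.

End DominatedLimits.

Section Filter.
Context {disp : measure_display} {T : measurableType disp} {R : realType}.
Variable Pr : probability T R.
Local Notation C := R[i].
Local Notation ip := (ip Pr).
Local Notation csqint := (csqint Pr).
Local Notation m2 X := (\int[Pr]_w normsq (X w))%R.
Implicit Types (c : int -> C) (V : int -> T -> C).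

Definition rnorm (z : C) : R := complex.Re `|z|.

Lemma rnormE z : (rnorm z)%:C = `|z|.
Proof. by rewrite RRe_real // ger0_real. Qed.

Lemma rnorm_ge0 z : 0 <= rnorm z.
Proof. by rewrite -ler0c rnormE. Qed.

Lemma normsq_rnorm z : normsq z = rnorm z ^+ 2.
Proof. by apply: complexI; rewrite normsqE rmorphXn /= rnormE. Qed.

Lemma rnormM z z' : rnorm (z * z') = rnorm z * rnorm z'.
Proof. by apply: complexI; rewrite rmorphM /= !rnormE normrM. Qed.

Lemma wsum_rnorm (a : int -> C) n :
  (wsum (fun j => rnorm (a j)) n)%:C = wsum (fun j => `|a j|) n.
Proof.
by rewrite rmorph_sum; apply: eq_bigr => j _; rewrite rmorphD /= !rnormE.
Qed.

Lemma wsum_cauchy_schwarz (F : realFieldType) (c x : int -> F) n :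
  (forall j, 0 <= c j) ->
  wsum (fun j => c j * x j) n ^+ 2 <=
  wsum c n * wsum (fun j => c j * x j ^+ 2) n.
Proof.
move=> c_ge0; pose e (i : 'I_n * bool) := if i.2 then Posz i.1 else Negz i.1.
have wE (a : int -> F) : wsum a n = \sum_(i : 'I_n * bool) a (e i).
  rewrite -(pair_bigA _ (fun i b => a (e (i, b)))) /=.
  by apply: eq_bigr => i _; rewrite big_bool.
rewrite !wE; apply: (@weighted_cauchy_schwarz _ _ _ (c \o e) (x \o e)) => i.
exact: c_ge0.
Qed.

(** The sum of the series [sum_j c_j V_j], as a measurable function: the upper
    limits of the real and imaginary parts of the partial sums are measurable
    also where the series diverges. *)
Definition filter_sum c V (w : T) : C :=
  fine (limn_esup (fun n => (complex.Re (wsum (fun j => c j * V j w) n))%:E))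
  +i*
  fine (limn_esup (fun n => (complex.Im (wsum (fun j => c j * V j w) n))%:E)).

Lemma cmeasurable_wsum c V n : (forall j, cmeasurable (V j)) ->
  cmeasurable (fun w => wsum (fun j => c j * V j w) n).
Proof.
move=> mV; apply: cmeasurable_sum => j _.
by apply: cmeasurableD; apply: cmeasurableM => //; exact: cmeasurable_cst.
Qed.

Lemma cmeasurable_filter_sum c V : (forall j, cmeasurable (V j)) ->
  cmeasurable (filter_sum c V).
Proof.
move=> mV; split; apply: (measurableT_comp (fine_measurable measurableT)) => /=;
  apply: measurable_fun_limn_esup => n; apply/measurable_EFinP;
  by have [] := cmeasurable_wsum c n mV.
Qed.

Lemma filter_sumE c V w S : conv (wsum (fun j => c j * V j w)) S ->
  filter_sum c V w = S.
Proof.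
move=> cS; rewrite /filter_sum; have Rc := conv_Re cS; have Ic := conv_Im cS.
have fE (u : nat -> R) (l : R) : u @ \oo --> l ->
    fine (limn_esup (fun n => (u n)%:E)) = l.
  move=> ul; have ulE : (fun n => (u n)%:E) @ \oo --> l%:E.
    by apply: cvg_EFin => //; exact: nearW.
  by have [_ ->] := cvg_limn_einf_sup ulE.
by rewrite (fE _ _ Rc) (fE _ _ Ic); case: (S).
Qed.

Section Domination.
Variables (c : int -> C) (V : int -> T -> C) (A B : R).
Hypothesis c_le : forall n, wsum (fun j => rnorm (c j)) n <= A.
Hypothesis Vi : forall j, csqint (V j).
Hypothesis V_le : forall j, m2 (V j) <= B.

Let g n w : R := wsum (fun j => rnorm (c j) * rnorm (V j w)) n.

(** The square of [sum_j |c_j| |V_j|], which dominates the squared modulus of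
    every partial sum. *)
Definition filter_dom (w : T) : \bar R := limn (fun n => (g n w ^+ 2)%:E).

Let mg n : measurable_fun setT (fun w => g n w ^+ 2).
Proof.
apply: measurable_funX; apply: measurable_sum => j.
have m k : measurable_fun setT (fun w => rnorm (V k w)).
  rewrite (_ : (fun w => _) = fun w => Num.sqrt (normsq (V k w))).
    apply: measurableT_comp; last by have [? _] := Vi k; exact: cmeasurable_normsq.
    by apply: continuous_measurable_fun; exact: sqrt_continuous.
  apply/funext => w; rewrite normsq_rnorm sqrtr_sqr ger0_norm //.
  exact: rnorm_ge0.
by apply: measurable_funD; apply: measurable_funM.
Qed.

Let g_ge0 n w : 0 <= g n w.
Proof. by apply: wsum_ge0 => j; rewrite mulr_ge0 ?rnorm_ge0. Qed.

Let g_nd w m n : (m <= n)%N -> g m w ^+ 2 <= g n w ^+ 2.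
Proof.
move=> mn; rewrite lerXn2r ?nnegrE // wsum_nd // => j.
by rewrite mulr_ge0 ?rnorm_ge0.
Qed.

Lemma filter_dom_ge w n : ((g n w ^+ 2)%:E <= filter_dom w)%E.
Proof.
rewrite /filter_dom (cvg_lim _ (ereal_nondecreasing_cvgn _)) //.
  by apply: ereal_sup_ubound; exists n.
by move=> m k mk; rewrite lee_fin g_nd.
Qed.

Let g2_le n w : g n w ^+ 2 <=
  A * wsum (fun j => rnorm (c j) * normsq (V j w)) n.
Proof.
apply: le_trans (wsum_cauchy_schwarz _ _ _) _; first by move=> j; exact: rnorm_ge0.
have -> : (fun j => rnorm (c j) * rnorm (V j w) ^+ 2) =
          (fun j => rnorm (c j) * normsq (V j w)).
  by apply/funext => j; rewrite normsq_rnorm.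
apply: ler_wpM2r => //; rewrite wsum_ge0 // => j.
by rewrite mulr_ge0 ?rnorm_ge0 ?normsq_ge0.
Qed.

(** By the weighted Cauchy-Schwarz inequality and monotone convergence, the
    second moment of [sum_j |c_j| |V_j|] is at most [sum_j |c_j|] times
    [sum_j |c_j| E |V_j|^2]. *)
Lemma filter_dom_integrable : Pr.-integrable setT filter_dom.
Proof.
have mgE n : measurable_fun setT (fun w => (g n w ^+ 2)%:E).
  exact/measurable_EFinP.
have g2_ge0 n w : (0 <= (g n w ^+ 2)%:E)%E by rewrite lee_fin sqr_ge0.
have g2_nd w m n : (m <= n)%N -> ((g m w ^+ 2)%:E <= (g n w ^+ 2)%:E)%E.
  by move=> mn; rewrite lee_fin g_nd.
have dom_ge0 w : (0 <= filter_dom w)%E.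
  exact: le_trans (g2_ge0 0%N w) (filter_dom_ge w 0).
have A_ge0 : 0 <= A.
  by apply: le_trans (c_le 0); apply: wsum_ge0 => j; exact: rnorm_ge0.
have B_ge0 : 0 <= B.
  by apply: le_trans (V_le 0); apply: Rintegral_ge0 => w _; exact: normsq_ge0.
have int_le n : (\int[Pr]_w (g n w ^+ 2)%:E <= (A * (A * B))%:E)%E.
  have ni j : rint Pr (fun w => normsq (V j w)) by have [] := Vi j.
  have si j : rint Pr (fun w => rnorm (c j) * normsq (V j w)).
    by apply: rintZ; have [_] := Vi j.
  have wi : rint Pr (fun w => wsum (fun j => rnorm (c j) * normsq (V j w)) n) /\
     (\int[Pr]_w wsum (fun j => rnorm (c j) * normsq (V j w)) n)%R <= A * B.
    have [-> ->] :
      (rint Pr (fun w => wsum (fun j => rnorm (c j) * normsq (V j w)) n) /\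
      (\int[Pr]_w wsum (fun j => rnorm (c j) * normsq (V j w)) n)%R =
      wsum (fun j => rnorm (c j) * m2 (V j)) n).
      elim: n => [|n [IHi IHe]].
        rewrite [wsum _ 0]big_ord0 (_ : (fun w => wsum _ 0) = fun=> 0).
          by split; [exact: rint_cst | rewrite Rintegral_cst // mul0r].
        by apply/funext => w; rewrite /wsum big_ord0.
      have E : (fun w => wsum (fun j => rnorm (c j) * normsq (V j w)) n.+1) =
          (fun w => wsum (fun j => rnorm (c j) * normsq (V j w)) n +
           (rnorm (c (Posz n)) * normsq (V (Posz n) w) +
            rnorm (c (Negz n)) * normsq (V (Negz n) w))).
        by apply/funext => w; rewrite wsumS.
      rewrite E wsumS; split; first exact: rintD IHi (rintD (si _) (si _)).
      rewrite RintegralD //; last exact: rintD.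
      rewrite (RintegralD measurableT (si (Posz n)) (si (Negz n))).
      rewrite (RintegralZl _ measurableT (ni (Posz n))).
      by rewrite (RintegralZl _ measurableT (ni (Negz n))) IHe.
    split=> //; apply: le_trans (_ : wsum (fun j => B * rnorm (c j)) n <= _).
      by apply: le_wsum => j; rewrite mulrC ler_wpM2r ?rnorm_ge0.
    by rewrite wsumZ mulrC ler_wpM2r.
  pose s w := A * wsum (fun j => rnorm (c j) * normsq (V j w)) n.
  have [wi1 wi2] := wi.
  apply: le_trans (_ : (\int[Pr]_w (s w)%:E <= _)%E).
    apply: ge0_le_integral => //.
    - apply/measurable_EFinP; apply: measurable_funM => //.
      exact: rint_measurable wi1.
    - by move=> w _; rewrite lee_fin; exact: g2_le.
  have sint : rint Pr s by exact: rintZ.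
  rewrite -(@fineK _ (\int[Pr]_w (s w)%:E)%E); last exact: integrable_fin_num sint.
  rewrite lee_fin -/(Rintegral Pr setT s) RintegralZl //.
  exact: ler_wpM2l.
apply/integrableP; split.
  apply: emeasurable_fun_cvg mgE _ => w _.
  by apply: ereal_nondecreasing_is_cvgn => m n; exact: g2_nd.
under eq_integral do rewrite gee0_abs //.
rewrite (@monotone_convergence _ _ _ Pr setT measurableT _ mgE) //; last first.
  by move=> w _ m n; exact: g2_nd.
apply: le_lt_trans (ltry (A * (A * B))).
apply: lime_le; last exact: nearW.
apply: ereal_nondecreasing_is_cvgn => m n mn.
by apply: ge0_le_integral => // w _; exact: g2_nd.
Qed.

Lemma filter_dom_normsq w n :
  ((normsq (wsum (fun j => c j * V j w) n))%:E <= filter_dom w)%E.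
Proof.
apply: le_trans (filter_dom_ge w n); rewrite lee_fin normsq_rnorm.
rewrite lerXn2r ?nnegrE ?rnorm_ge0 ?g_ge0 // -lecR rnormE.
apply: le_trans (norm_wsum _ _) _; rewrite -wsum_rnorm lecR le_eqVlt.
by apply/orP; left; apply/eqP; apply: eq_bigr => j _; rewrite !rnormM.
Qed.

Lemma filter_sum_sums :
  {ae Pr, forall w, sumsZ (fun j => c j * V j w) (filter_sum c V w)}.
Proof.
have := integrable_ae measurableT filter_dom_integrable.
apply: filterS => w /(_ I) dom_fin.
have [S cS] : exists S, sumsZ (fun j => c j * V j w) S.
  apply: summableZ_sums; exists (1 + fine (filter_dom w))%:C => n.
  rewrite -wsum_rnorm lecR.
  have -> : wsum (fun j => rnorm (c j * V j w)) n = g n w.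
    by apply: eq_bigr => j _; rewrite !rnormM.
  have g2 : g n w ^+ 2 <= fine (filter_dom w).
    by rewrite -lee_fin fineK // filter_dom_ge.
  have := g_ge0 n w; move: g2; set x := g n w; set y := fine _ => h1 h2; nra.
by rewrite (filter_sumE cS.2).
Qed.

Lemma csqint_wsum n : csqint (fun w => wsum (fun j => c j * V j w) n).
Proof.
by apply: csqint_sum => j _; apply: csqintD; apply: csqintZ.
Qed.

Lemma csqint_filter_sum : csqint (filter_sum c V).
Proof.
have mV j : cmeasurable (V j) by have [] := Vi j.
apply: (csqint_limit (X_ := fun n w => wsum (fun j => c j * V j w) n)
  (H := filter_dom)).
- by move=> n; exact: cmeasurable_wsum.
- exact: cmeasurable_filter_sum.
- by apply: filterS filter_sum_sums => w [].
- exact: filter_dom_integrable.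
- exact: filter_dom_normsq.
Qed.

End Domination.

Lemma summableZ_rnorm c : summableZ c ->
  exists A, forall n, wsum (fun j => rnorm (c j)) n <= A.
Proof.
move=> [A c_le]; exists (complex.Re A) => n; move: (c_le n).
by rewrite -wsum_rnorm lecE => /andP[].
Qed.

(** Covariances of outputs of filters are limits of those of the partial sums,
    hence only depend on the covariances of the inputs. *)
Lemma ip_filter_sum c c' (V V' X X' : int -> T -> C) B :
  summableZ c -> summableZ c' ->
  (forall j, csqint (V j) /\ m2 (V j) <= B) ->
  (forall j, csqint (V' j) /\ m2 (V' j) <= B) ->
  (forall j, csqint (X j) /\ m2 (X j) <= B) ->
  (forall j, csqint (X' j) /\ m2 (X' j) <= B) ->
  (forall i j, ip (V i) (V' j) = ip (X i) (X' j)) ->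
  ip (filter_sum c V) (filter_sum c' V') = ip (filter_sum c X) (filter_sum c' X').
Proof.
move=> /summableZ_rnorm[A cA] /summableZ_rnorm[A' cA'] Vb V'b Xb X'b ipE.
have lim (U U' : int -> T -> C) :
    (forall j, csqint (U j) /\ m2 (U j) <= B) ->
    (forall j, csqint (U' j) /\ m2 (U' j) <= B) ->
    conv (fun n => ip (fun w => wsum (fun j => c j * U j w) n)
                      (fun w => wsum (fun j => c' j * U' j w) n))
         (ip (filter_sum c U) (filter_sum c' U')).
  move=> Ub U'b.
  have Ui j : csqint (U j) by have [] := Ub j.
  have U'i j : csqint (U' j) by have [] := U'b j.
  have Um j : m2 (U j) <= B by have [] := Ub j.
  have U'm j : m2 (U' j) <= B by have [] := U'b j.
  apply: (ip_limit (H := filter_dom c U) (H' := filter_dom c' U')).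
  - by move=> n; have [] := csqint_wsum c Ui n.
  - by have [] := csqint_filter_sum cA Ui Um.
  - by move=> n; have [] := csqint_wsum c' U'i n.
  - by have [] := csqint_filter_sum cA' U'i U'm.
  - by apply: filterS (filter_sum_sums cA Ui Um) => w [].
  - by apply: filterS (filter_sum_sums cA' U'i U'm) => w [].
  - exact: filter_dom_integrable cA Ui Um.
  - exact: filter_dom_normsq.
  - exact: filter_dom_integrable cA' U'i U'm.
  - exact: filter_dom_normsq.
have ip_wsum (U U' : int -> T -> C) n :
    (forall j, csqint (U j) /\ m2 (U j) <= B) ->
    (forall j, csqint (U' j) /\ m2 (U' j) <= B) ->
    ip (fun w => wsum (fun j => c j * U j w) n)
       (fun w => wsum (fun j => c' j * U' j w) n) =
    wsum (fun i => c i * wsum (fun j => (c' j)^* * ip (U i) (U' j)) n) n.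
  move=> Ub U'b.
  have Ui j : csqint (U j) by have [] := Ub j.
  have U'i j : csqint (U' j) by have [] := U'b j.
  pose e (i : 'I_n * bool) := if i.2 then Posz i.1 else Negz i.1.
  have wE (a : int -> C) : wsum a n = \sum_(i : 'I_n * bool) a (e i).
    rewrite -(pair_bigA _ (fun i b => a (e (i, b)))) /=.
    by apply: eq_bigr => i _; rewrite big_bool.
  rewrite wE.
  have -> : (fun w => wsum (fun j => c j * U j w) n) =
            (fun w => \sum_i c (e i) * U (e i) w) by apply/funext => w; exact: wE.
  have -> : (fun w => wsum (fun j => c' j * U' j w) n) =
            (fun w => \sum_i c' (e i) * U' (e i) w) by apply/funext => w; exact: wE.
  rewrite ip_suml //; last by apply: csqint_sum => i _; exact: csqintZ.
  by apply: eq_bigr => i _; rewrite wE ip_sumr.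
apply: conv_unique (lim _ _ Vb V'b) _.
apply: eq_conv (lim _ _ Xb X'b) => n; rewrite !ip_wsum //.
congr (wsum _ n); apply/funext => i; congr (_ * wsum _ n).
by apply/funext => j; rewrite ipE.
Qed.

(** The expectation is the inner product with the constant [1]. *)
Lemma cexpectation_filter_sum c V B : summableZ c ->
  (forall j, csqint (V j) /\ m2 (V j) <= B) ->
  (forall j, cexpectation Pr (V j) = 0) ->
  cexpectation Pr (filter_sum c V) = 0.
Proof.
move=> /summableZ_rnorm[A cA] Vb V0.
have Vi j : csqint (V j) by have [] := Vb j.
have Vm j : m2 (V j) <= B by have [] := Vb j.
have ip1 X : ip X (fun=> 1) = cexpectation Pr X.
  by rewrite /ip; under eq_fun do rewrite conjC1 mulr1.
rewrite -ip1.
apply: (@conv_unique _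
  (fun n => ip (fun w => wsum (fun j => c j * V j w) n) (fun=> 1))).
  apply: (ip_limit (H := filter_dom c V) (H' := fun=> 1%E)).
  - by move=> n; have [] := csqint_wsum c Vi n.
  - by have [] := csqint_filter_sum cA Vi Vm.
  - by move=> n; exact: cmeasurable_cst.
  - exact: cmeasurable_cst.
  - by apply: filterS (filter_sum_sums cA Vi Vm) => w [].
  - by apply: nearW => w; exact: conv_cst.
  - exact: filter_dom_integrable cA Vi Vm.
  - exact: filter_dom_normsq.
  - exact: (rint_cst Pr 1).
  - by move=> w n; rewrite /normsq /= expr1n expr0n addr0.
apply: eq_conv (conv_cst 0) => n; rewrite ip1.
rewrite cexpectation_sum => [|i _]; last first.
  by apply: csqint_cint; apply: csqintD; exact: csqintZ.
rewrite big1 // => i _; rewrite cexpectationD; do ?by apply/csqint_cint/csqintZ.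
by rewrite !cexpectationZ ?V0 ?mulr0 ?addr0 //; exact: csqint_cint.
Qed.

End Filter.

(** * Matrix filters and the ARMA polynomials *)

Section MatrixFilters.
Variable K : comNzRingType.

Definition mx_act a b (A : 'M[{poly K}]_(a, b)) (x : 'I_b -> int -> K) :
    'I_a -> int -> K :=
  fun i t => \sum_j shift_act (A i j) (x j) t.

Lemma mx_actM a b c (A : 'M[{poly K}]_(a, b)) (B : 'M[{poly K}]_(b, c))
    (x : 'I_c -> int -> K) i t :
  mx_act (A *m B) x i t = mx_act A (mx_act B x) i t.
Proof.
transitivity (\sum_k \sum_j shift_act (A i j) (shift_act (B j k) (x k)) t).
  apply: eq_bigr => k _; rewrite mxE shift_act_suml.
  by apply: eq_bigr => j _; rewrite shift_actM.
rewrite exchange_big; apply: eq_bigr => j _.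
by rewrite /mx_act shift_act_sumr.
Qed.

Lemma mx_act_scalar a (p : {poly K}) (x : 'I_a -> int -> K) i t :
  mx_act p%:M x i t = shift_act p (x i) t.
Proof.
rewrite /mx_act (bigD1 i) //= mxE eqxx mulr1n big1 ?addr0 // => j ji.
by rewrite mxE eq_sym (negPf ji) mulr0n shift_act0l.
Qed.

Lemma mx_act_cst a b (A : 'M[{poly K}]_(a, b)) (v : 'cV[K]_b) i t :
  mx_act A (fun j _ => v j 0) i t = (map_mx (horner_eval 1) A *m v) i 0.
Proof. by rewrite mxE; apply: eq_bigr => j _; rewrite shift_act_cst mxE. Qed.

Lemma mx_act_polyC a b (A : 'M[K]_(a, b)) (x : int -> 'cV[K]_b) i t :
  mx_act (map_mx polyC A) (fun j u => x u j 0) i t = (A *m x t) i 0.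
Proof. by rewrite mxE; apply: eq_bigr => j _; rewrite mxE shift_actC. Qed.

Lemma eq_mx_act a b (A : 'M[{poly K}]_(a, b)) (x y : 'I_b -> int -> K) i t :
  (forall j u, x j u = y j u) -> mx_act A x i t = mx_act A y i t.
Proof. by move=> xy; apply: eq_bigr => j _; apply: eq_shift_act. Qed.

Lemma mx_actB a b (A : 'M[{poly K}]_(a, b)) (x y : 'I_b -> int -> K) i t :
  mx_act A (fun j u => x j u - y j u) i t = mx_act A x i t - mx_act A y i t.
Proof.
rewrite -sumrB; apply: eq_bigr => j _.
have -> : shift_act (A i j) (fun u => x j u - y j u) t =
    shift_act (A i j) (fun u => x j u + - 1 * y j u) t.
  by apply: eq_shift_act => u; rewrite mulN1r.
by rewrite shift_act_addr shift_actZr mulN1r.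
Qed.

End MatrixFilters.

Section ArmaPolynomials.
Variable R : realType.
Local Notation C := R[i].
Variables (m d p q : nat) (Psi : nat -> 'M[C]_m) (Theta : nat -> 'M[C]_(m, d)).

Definition poly_P : 'M[{poly C}]_m :=
  1%:M - \sum_(1 <= k < p.+1) map_mx (fun a => a *: 'X^k) (Psi k).

Definition poly_Q : 'M[{poly C}]_(m, d) :=
  \sum_(0 <= k < q.+1) map_mx (fun a => a *: 'X^k) (Theta k).

Lemma horner_poly_P z : map_mx (horner_eval z) poly_P = arma_P p Psi z.
Proof.
rewrite /poly_P /arma_P map_mxB map_mx1; congr (_ - _).
rewrite raddf_sum; apply: eq_bigr => k _; apply/matrixP => i j.
by rewrite !mxE /= /horner_eval hornerZ hornerXn mulrC.
Qed.

Lemma horner_poly_Q z : map_mx (horner_eval z) poly_Q = arma_Q q Theta z.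
Proof.
rewrite /poly_Q /arma_Q raddf_sum; apply: eq_bigr => k _; apply/matrixP => i j.
by rewrite !mxE /= /horner_eval hornerZ hornerXn mulrC.
Qed.

Lemma mx_act_coef a b (B : 'M[C]_(a, b)) k (x : int -> 'cV[C]_b) i t :
  mx_act (map_mx (fun a => a *: 'X^k) B) (fun j u => x u j 0) i t =
  (B *m x (t - k%:Z)) i 0.
Proof. by rewrite mxE; apply: eq_bigr => j _; rewrite mxE shift_actZXn. Qed.

Lemma mx_act_sum a b (I : Type) (r : seq I) (A : I -> 'M[{poly C}]_(a, b))
    (x : 'I_b -> int -> C) i t :
  mx_act (\sum_(k <- r) A k) x i t = \sum_(k <- r) mx_act (A k) x i t.
Proof.
rewrite exchange_big; apply: eq_bigr => j _.
by rewrite summxE shift_act_suml.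
Qed.

Lemma mx_act_poly_P (y : int -> 'cV[C]_m) i t :
  mx_act poly_P (fun j u => y u j 0) i t =
  (y t - \sum_(1 <= k < p.+1) Psi k *m y (t - k%:Z)) i 0.
Proof.
have -> : mx_act poly_P (fun j u => y u j 0) i t =
    mx_act 1%:M (fun j u => y u j 0) i t - mx_act
    (\sum_(1 <= k < p.+1) map_mx (fun a => a *: 'X^k) (Psi k))
    (fun j u => y u j 0) i t.
  rewrite -sumrB; apply: eq_bigr => j _.
  by rewrite !mxE shift_act_addl -scaleN1r shift_actZl mulN1r.
rewrite mx_act_scalar shift_act1 mx_act_sum !mxE summxE; congr (_ - _).
by apply: eq_bigr => k _; rewrite mx_act_coef.
Qed.

Lemma mx_act_poly_Q (z : int -> 'cV[C]_d) i t :
  mx_act poly_Q (fun j u => z u j 0) i t =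
  (\sum_(0 <= k < q.+1) Theta k *m z (t - k%:Z)) i 0.
Proof.
by rewrite mx_act_sum summxE; apply: eq_bigr => k _; rewrite mx_act_coef.
Qed.

(** A polynomial in the backshift acts on constants by its value at [1], so that
    [P(1) g = Q(1) e] allows subtracting [g] and [e] on the two sides. *)
Lemma arma_centred (y : int -> 'cV[C]_m) (z : int -> 'cV[C]_d)
    (g : 'cV[C]_m) (e : 'cV[C]_d) t :
  arma_P p Psi 1 *m g = arma_Q q Theta 1 *m e ->
  (y t - \sum_(1 <= k < p.+1) Psi k *m y (t - k%:Z) =
   \sum_(0 <= k < q.+1) Theta k *m z (t - k%:Z)) <->
  (forall i, mx_act poly_P (fun j u => y u j 0 - g j 0) i t =
             mx_act poly_Q (fun j u => z u j 0 - e j 0) i t).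
Proof.
move=> ge; have eqi i : mx_act poly_P (fun j _ => g j 0) i t =
    mx_act poly_Q (fun j _ => e j 0) i t.
  by rewrite !mx_act_cst horner_poly_P horner_poly_Q ge.
split=> [yz i|yz].
  by rewrite !mx_actB eqi mx_act_poly_P (mx_act_poly_Q z) yz.
apply/matrixP => i j; rewrite (ord1 j) -mx_act_poly_P -mx_act_poly_Q.
by have := yz i; rewrite !mx_actB eqi => /addIr.
Qed.

Definition det_P : {poly C} := \det poly_P.

Lemma horner_det_P z : det_P.[z] = \det (arma_P p Psi z).
Proof. by rewrite -horner_poly_P det_map_mx. Qed.

Lemma det_P_neq0 : det_P != 0.
Proof.
apply/eqP => d0; have := horner_det_P 0; rewrite d0 horner0 /arma_P.
rewrite big_nat big1 => [|k /andP[k1 _]]; last first.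
  by rewrite expr0n; case: k k1 => // k _; rewrite scale0r.
by rewrite subr0 det1 => /eqP; rewrite eq_sym oner_eq0.
Qed.

End ArmaPolynomials.

Section Corner.
Variable R : realType.
Local Notation C := R[i].

Lemma corner_diag s d (hs : (s <= d)%N) (v : 'rV[C]_s) (i j : 'I_d) :
  corner_mx hs (diag_mx v) i j =
  if i == j then oapp (fun k : 'I_s => v 0 k) 0 (insub (i : nat)) else 0.
Proof.
have insubE (k : 'I_s) : insub (k : nat) = Some k by exact: valK.
rewrite /corner_mx castmxE mxE.
case: splitP => [i' /= ii'|i' /= ii']; rewrite mxE.
  case: splitP => [j' /= jj'|j' /= jj'].
    rewrite !mxE ii' insubE /= -[i == j]/((i : nat) == j) ii' jj'.
    by rewrite -[(i' : nat) == j']/(i' == j'); case: eqP; rewrite ?mulr1n ?mulr0n.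
  rewrite mxE ifN //; apply/eqP => ij; move: ii'; rewrite ij jj' => sj.
  by have := ltn_ord i'; rewrite -sj ltnNge leq_addr.
have nins : insub (i : nat) = None :> option 'I_s.
  by apply: insubN; rewrite ii' -leqNgt leq_addr.
by case: splitP => j' _; rewrite !mxE nins /=; case: ifP.
Qed.

Lemma mul_corner1 s d m (hs : (s <= d)%N) (A : 'M[C]_(m, d)) i (k : 'I_d) :
  (A *m corner_mx hs 1%:M) i k = if (k < s)%N then A i k else 0.
Proof.
have -> : 1%:M = diag_mx (const_mx 1) :> 'M[C]_s by rewrite diag_const_mx.
rewrite mxE (bigD1 k) //= big1 => [|j jk]; last first.
  by rewrite corner_diag (negPf jk) mulr0.
rewrite addr0 corner_diag eqxx.
case: ifP => ks; first by rewrite insubT /= mxE mulr1.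
by rewrite insubF //= mulr0.
Qed.

End Corner.

(** * Weakly stationary processes and white noise *)

Section Stationary.
Context {disp : measure_display} {T : measurableType disp} {R : realType}.
Variable Pr : probability T R.
Local Notation C := R[i].
Local Notation ip := (ip Pr).
Local Notation csqint := (csqint Pr).
Local Notation cE := (cexpectation Pr).
Local Notation m2 X := (\int[Pr]_w normsq (X w))%R.

Lemma finite_second_moment_coord r (X : T -> 'cV[C]_r) i :
  random_vector X -> finite_second_moment Pr X -> csqint (fun w => X w i 0).
Proof.
move=> mX Xi; apply/csqint_finite_second_moment; split; first exact: mX.
apply: le_lt_trans Xi; apply: ge0_le_integral => //.
- by move=> w _; rewrite lee_fin normsq_ge0.
- by apply/measurable_EFinP; apply: cmeasurable_normsq; exact: mX.
- apply/measurable_EFinP; apply: measurable_sum => j.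
  by apply: (@cmeasurable_normsq _ _ _ (fun w => X w j 0)); exact: mX.
- move=> w _; rewrite lee_fin (bigD1 i) //= lerDl; apply: sumr_ge0 => j _.
  exact: (normsq_ge0 (X w j 0)).
Qed.

Lemma coord_finite_second_moment r (X : T -> 'cV[C]_r) :
  (forall i, csqint (fun w => X w i 0)) ->
  random_vector X /\ finite_second_moment Pr X.
Proof.
move=> Xi; split=> [i|]; first by have [] := Xi i.
have sum_rint (s : seq 'I_r) : rint Pr (fun w => \sum_(i <- s) normsq (X w i 0)).
  elim: s => [|i s IH].
    by under eq_fun do rewrite big_nil; exact: rint_cst.
  by under eq_fun do rewrite big_cons; apply: rintD => //; have [] := Xi i.
have /integrableP[_] := sum_rint (index_enum _).
rewrite /finite_second_moment.
have -> // : (fun w => `|(EFin \o (fun w => (\sum_i normsq (X w i 0))%R)) w|%E) =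
     (fun w => (\sum_i (complex.Re (X w i 0) ^+ 2 +
                       complex.Im (X w i 0) ^+ 2))%:E).
apply/funext => w; rewrite gee0_abs //= lee_fin.
by apply: sumr_ge0 => i _; exact: normsq_ge0.
Qed.

Lemma ae_forall_int (P : int -> T -> Prop) :
  (forall t, {ae Pr, forall w, P t w}) -> {ae Pr, forall w t, P t w}.
Proof.
move=> Pt; have h1 := ae_foralln (fun n => Pt (Posz n)).
have h2 := ae_foralln (fun n => Pt (Negz n)).
by apply: filterS2 h1 h2 => w Pw1 Pw2 [n|n].
Qed.

Lemma ae_forall_fin (I : finType) (P : I -> T -> Prop) :
  (forall i, {ae Pr, forall w, P i w}) -> {ae Pr, forall w i, P i w}.
Proof.
move=> Pi; have : {ae Pr, forall w, forall i, i \in enum I -> P i w}.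
  elim: (enum I) => [|i s IH]; first exact: nearW.
  apply: filterS2 (Pi i) IH => w Piw IHw j.
  by rewrite inE => /orP[/eqP ->|/IHw].
by apply: filterS => w Pw i; apply: Pw; rewrite mem_enum.
Qed.

Lemma cexpectation_shift_act (p : {poly C}) (x : int -> T -> C) t :
  (forall u, cint Pr (x u)) ->
  cE (filter_process p x t) = shift_act p (fun u => cE (x u)) t.
Proof.
move=> xi; rewrite /filter_process cexpectation_sum.
  by apply: eq_bigr => k _; rewrite cexpectationZ.
by move=> k _; exact: cintZ.
Qed.

Lemma vcovarianceE r l (X : T -> 'cV[C]_r) (Y : T -> 'cV[C]_l) e f i j :
  vexpectation Pr X = e -> vexpectation Pr Y = f ->
  vcovariance Pr X Y i j =
  ip (fun w => X w i 0 - e i 0) (fun w => Y w j 0 - f j 0).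
Proof.
move=> Xe Yf; rewrite /vcovariance Xe Yf mxE /ip.
by congr (cE _); apply/funext => w; rewrite mxE big_ord1 !mxE.
Qed.

Section Centred.
Variables (r : nat) (X : int -> T -> 'cV[C]_r).
Hypothesis X_ws : weakly_stationary Pr X.

Definition centred (j : 'I_r) (t : int) (w : T) : C :=
  X t w j 0 - vexpectation Pr (X 0) j 0.

Lemma ws_csqint t j : csqint (fun w => X t w j 0).
Proof.
by have [mX Xi _ _] := X_ws; exact: finite_second_moment_coord (mX t) (Xi t).
Qed.

Lemma ws_mean t j : cE (fun w => X t w j 0) = vexpectation Pr (X 0) j 0.
Proof. by have [_ _ Xm _] := X_ws; rewrite (Xm 0 t) mxE. Qed.

Lemma centred_csqint t j : csqint (centred j t).
Proof. by apply: csqintD; [exact: ws_csqint|exact: csqint_cst]. Qed.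

Lemma centred_mean t j : cE (centred j t) = 0.
Proof.
rewrite cexpectationD; last exact: cint_cst.
  by rewrite cexpectation_cst ws_mean subrr.
exact/csqint_cint/ws_csqint.
Qed.

Lemma ip_centred t u i j :
  ip (centred i t) (centred j u) = vcovariance Pr (X t) (X u) i j.
Proof.
have [_ _ Xm _] := X_ws.
by rewrite (vcovarianceE i j (Xm t 0) (Xm u 0)).
Qed.

Lemma centred_m2 t j :
  m2 (centred j t) = complex.Re (vcovariance Pr (X 0) (X 0) j j).
Proof.
have [_ _ _ Xc] := X_ws.
by have := Xc 0 t 0; rewrite !addr0 => <-; rewrite -ip_centred ip_self.
Qed.

End Centred.

Section Noise.
Variables (d s : nat) (s_le_d : (s <= d)%N).
Variables (Z : int -> T -> 'cV[C]_d) (U : 'M[C]_d) (D : 'rV[R]_s).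
Hypothesis Z_noise : weak_white_noise Pr Z.
Hypothesis U_unitary : U \is unitarymx.
Hypothesis D_gt0 : forall i, 0 < D 0 i.
Hypothesis U_diag : U *m vcovariance Pr (Z 0) (Z 0) *m (U ^t*)%sesqui =
  corner_mx s_le_d (diag_mx (map_mx (real_complex R) D)).

Let EZ := vexpectation Pr (Z 0).

(** The noise in the coordinates that diagonalize its covariance. *)
Definition rotated (k : 'I_d) (t : int) (w : T) : C :=
  (U *m (Z t w - EZ)) k 0.

(** The eigenvalues of the covariance, padded by zeros from the index [s] on. *)
Definition noise_var (k : 'I_d) : R :=
  oapp (fun i : 'I_s => D 0 i) 0 (insub (k : nat)).

Lemma noise_var_ge0 k : 0 <= noise_var k.
Proof. by rewrite /noise_var; case: insub => //= i; exact: ltW. Qed.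

Lemma noise_var_gt0 (k : 'I_d) : (k < s)%N -> 0 < noise_var k.
Proof. by move=> ks; rewrite /noise_var insubT /=. Qed.

Lemma noise_var_eq0 (k : 'I_d) : (s <= k)%N -> noise_var k = 0.
Proof. by move=> ks; rewrite /noise_var insubF //= ltnNge ks. Qed.

Lemma rotatedE k t :
  rotated k t = fun w => \sum_j U k j * centred Z j t w.
Proof.
apply/funext => w; rewrite /rotated mxE; apply: eq_bigr => j _.
by rewrite /centred !mxE.
Qed.

Lemma rotated_csqint k t : csqint (rotated k t).
Proof.
rewrite rotatedE; apply: csqint_sum => j _; apply: csqintZ.
by apply: centred_csqint; have [] := Z_noise.
Qed.

Lemma rotated_mean k t : cE (rotated k t) = 0.
Proof.
have [Zws _] := Z_noise.
rewrite rotatedE cexpectation_sum => [|j _].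
  rewrite big1 // => j _; rewrite cexpectationZ ?centred_mean ?mulr0 //.
  exact/csqint_cint/centred_csqint.
by apply: cintZ; exact/csqint_cint/centred_csqint.
Qed.

Lemma ip_rotated k k' t t' : ip (rotated k t) (rotated k' t') =
  if (k == k') && (t == t') then (noise_var k)%:C else 0.
Proof.
have [Zws Z_wn] := Z_noise.
have Zi := centred_csqint Zws.
have -> : ip (rotated k t) (rotated k' t') =
    (U *m vcovariance Pr (Z t) (Z t') *m (U ^t*)%sesqui) k k'.
  rewrite !rotatedE ip_suml //; last first.
    by apply: csqint_sum => j _; exact: csqintZ.
  rewrite -mulmxA mxE; apply: eq_bigr => i _; congr (_ * _).
  rewrite ip_sumr // mxE; apply: eq_bigr => j _.
  by rewrite ip_centred // mulrC !mxE.
have [<-|/eqP tt'] := eqVneq t t'; last first.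
  by rewrite Z_wn // mulmx0 mul0mx mxE andbF.
have [_ _ _ Zc] := Zws; have := Zc 0 t 0; rewrite !addr0 => ->.
rewrite U_diag corner_diag andbT; case: eqP => // _.
by rewrite /noise_var; case: insub => //= i; rewrite mxE.
Qed.

Lemma rotated_m2 k t : m2 (rotated k t) = noise_var k.
Proof.
by apply: complexI; rewrite -ip_self ip_rotated !eqxx.
Qed.

Lemma rotated_eq0 (k : 'I_d) t : (s <= k)%N -> {ae Pr, forall w, rotated k t w = 0}.
Proof.
move=> sk; have [mW Wi] := rotated_csqint k t.
have mn : measurable_fun setT (fun w => (normsq (rotated k t w))%:E).
  exact/measurable_EFinP/cmeasurable_normsq.
have : (\int[Pr]_w `|(normsq (rotated k t w))%:E| = 0)%E.
  under eq_integral do rewrite gee0_abs ?lee_fin ?normsq_ge0 //.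
  rewrite -[LHS]fineK; last exact: integrable_fin_num Wi.
  by congr (_%:E); have := rotated_m2 k t; rewrite noise_var_eq0.
move=> /(ae_eq_integral_abs _ measurableT mn); apply: filterS => w /(_ I) [].
move=> n0; apply/eqP; rewrite -normr_eq0 -sqrf_eq0 -normsqE.
by rewrite n0.
Qed.

(** The matrix [U^* U] is the identity, so the noise can be recovered from its
    rotated coordinates. *)
Lemma mx_act_rotated a (A : 'M[{poly C}]_(a, d)) i t w :
  mx_act A (fun j u => centred Z j u w) i t =
  mx_act (A *m map_mx polyC (U ^t*)%sesqui) (fun k u => rotated k u w) i t.
Proof.
rewrite mx_actM; apply: eq_mx_act => j u.
rewrite (mx_act_polyC _ (fun u => U *m (Z u w - EZ))) mulmxA.
have -> : (U ^t*)%sesqui *m U = 1%:M.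
  by rewrite -invmx_unitary // mulVmx // unitarymx_unit.
by rewrite mul1mx /centred !mxE.
Qed.

End Noise.

End Stationary.

(** * The transfer function of the ARMA equation *)

Section Transfer.
Variable R : realType.
Local Notation C := R[i].
Variables (m d p q s : nat) (s_le_d : (s <= d)%N).
Variables (Psi : nat -> 'M[C]_m) (Theta : nat -> 'M[C]_(m, d)) (U : 'M[C]_d).

Local Notation P := (poly_P p Psi).
Local Notation delta := (det_P p Psi).
Local Notation M := (arma_M p q s_le_d Psi Theta U).
Local Notation sing := (arma_sing p Psi).

(** [Q U^*], and its truncation [N = P M] to the nondegenerate coordinates. *)
Definition poly_QU : 'M[{poly C}]_(m, d) :=
  poly_Q q Theta *m map_mx polyC (U ^t*)%sesqui.

Definition poly_N : 'M[{poly C}]_(m, d) :=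
  \matrix_(i, k) if (k < s)%N then poly_QU i k else 0.

(** The numerators of the entries of [M] over the common denominator
    [det P]. *)
Definition numer (i : 'I_m) (k : 'I_d) : {poly C} :=
  if (k < s)%N then (\adj P *m poly_QU) i k else 0.

Lemma singE z : sing z <-> delta.[z] = 0.
Proof. by rewrite /arma_sing /= horner_det_P. Qed.

Lemma horner_poly_QU z :
  map_mx (horner_eval z) poly_QU = arma_Q q Theta z *m (U ^t*)%sesqui.
Proof.
rewrite map_mxM horner_poly_Q; congr (_ *m _); apply/matrixP => i j.
by rewrite !mxE /= /horner_eval hornerC.
Qed.

Lemma arma_M_entry z i k : delta.[z] != 0 ->
  M z i k = (numer i k).[z] / delta.[z].
Proof.
move=> dz; rewrite mul_corner1 /numer; case: ifP => _; last first.
  by rewrite horner0 mul0r.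
have Pu : arma_P p Psi z \in unitmx by rewrite unitmxE unitfE -horner_det_P.
rewrite /invmx Pu -mulmxA -horner_poly_QU -horner_poly_P -map_mx_adj.
rewrite -scalemxAl -map_mxM det_map_mx mxE mulrC; congr (_ / _).
by rewrite mxE.
Qed.

Lemma arma_P_M z : delta.[z] != 0 ->
  arma_P p Psi z *m M z = map_mx (horner_eval z) poly_N.
Proof.
move=> dz; have Pu : arma_P p Psi z \in unitmx.
  by rewrite unitmxE unitfE -horner_det_P.
rewrite /arma_M -!mulmxA mulKVmx // mulmxA -horner_poly_QU.
apply/matrixP => i k; rewrite mul_corner1 !mxE.
by case: ifP => _ //; rewrite /horner_eval horner0.
Qed.

Lemma removable_entry z i k :
  removable_singularity (fun z => M z i k) z <->
  (delta %/ gcdp (numer i k) delta).[z] != 0.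
Proof.
apply: removable_fraction; first exact: det_P_neq0.
by move=> u; exact: arma_M_entry.
Qed.

Lemma entry_laurent i k : removable_on_unit_circle sing M ->
  exists (n : nat) (a : int -> C), forall z,
    1 - n.+1%:R^-1 < `|z| < 1 + n.+1%:R^-1 ->
    exists2 S, sumsZ (fun j => z ^ j * a j) S & (delta.[z] != 0 -> S = M z i k).
Proof.
move=> Mrem; pose G := gcdp (numer i k) delta.
have nE : numer i k = (numer i k %/ G) * G by rewrite divpK // dvdp_gcdl.
have dE : delta = (delta %/ G) * G by rewrite divpK // dvdp_gcdr.
have den_neq0 : delta %/ G != 0.
  by apply: contra_neq (det_P_neq0 p Psi) => d0; rewrite dE d0 mul0r.
have den_circle z : `|z| = 1 -> ~~ root (delta %/ G) z.
  move=> z1; apply/negP => /eqP dz.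
  have sz : sing z by apply/singE; rewrite dE hornerM dz mul0r.
  by have /removable_entry/eqP := Mrem z z1 sz i k.
have [n [a [aE aP]]] := laurent_rational (numer i k %/ G) den_neq0 den_circle.
exists n, a => z zn; have [dz a_s] := aP z zn.
have [S aS] := summableZ_sums a_s; exists S => // dz0.
have z0 : z != 0.
  rewrite -normr_gt0; have /andP[h _] := zn; apply: le_lt_trans h.
  by rewrite subr_ge0 invf_le1 ?ltr0n // ler1n.
have h1 := laurent_eval (delta %/ G) z0 aS.
have h2 : sumsZ (fun j => z ^ j * shift_act (delta %/ G) a j) (numer i k %/ G).[z].
  by apply: eq_sumsZ (laurent_poly _ z) => j; rewrite aE.
have dS := sumsZ_unique h1 h2.
rewrite arma_M_entry // nE; move: dz0; rewrite [in X in X -> _]dE [X in _ / X.[z]]dE.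
rewrite !hornerM mulf_eq0 negb_or => /andP[_ Gz].
by rewrite -mulf_div divff // mulr1 -dS mulrAC divff // mul1r.
Qed.

Lemma laurent_exists : removable_on_unit_circle sing M ->
  exists M_ : int -> 'M[C]_(m, d), laurent_near_unit_circle sing M M_.
Proof.
move=> Mrem.
have /boolp.choice[na naP] (x : 'I_m * 'I_d) : exists na : nat * (int -> C),
    forall z, 1 - na.1.+1%:R^-1 < `|z| < 1 + na.1.+1%:R^-1 ->
    exists2 S, sumsZ (fun j => z ^ j * na.2 j) S &
      (delta.[z] != 0 -> S = M z x.1 x.2).
  by have [n [a naP]] := entry_laurent x.1 x.2 Mrem; exists (n, a).
pose N := \max_x (na x).1.
exists (fun j => \matrix_(i, k) (na (i, k)).2 j), N.+2%:R^-1; split.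
  by rewrite invr_gt0 ltr0n /= invf_lt1 ?ltr0n // ltr1n.
move=> z /andP[z1 z2].
have /boolp.choice[S SP] (x : 'I_m * 'I_d) : exists S,
    sumsZ (fun j => z ^ j * (na x).2 j) S /\ (delta.[z] != 0 -> S = M z x.1 x.2).
  have le_e : N.+2%:R^-1 <= (na x).1.+1%:R^-1 :> C.
    rewrite lef_pV2 ?posrE ?ltr0n // ler_nat ltnS ltnW // ltnS.
    exact: (leq_bigmax (F := fun x => (na x).1)).
  have [|S S1 S2] := naP x z; last by exists S.
  by rewrite (le_lt_trans _ z1) ?lerD2l ?lerN2 //= (lt_le_trans z2) // lerD2l.
exists (\matrix_(i, k) S (i, k)).
  move=> i k; apply/has_sumZP; rewrite mxE; have [+ _] := SP (i, k).
  by apply: eq_sumsZ => j; rewrite !mxE.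
move=> nz; apply/matrixP => i k; rewrite mxE; have [_ ->] := SP (i, k) => //.
by apply/eqP => dz; apply: nz; apply/singE.
Qed.

(** Coefficients are determined by the values on a full circle, while the series
    represents [M] only off the singularities; these have finitely many
    moduli. *)
Lemma regular_radius (e : C) : 0 < e ->
  exists r : C, 1 < r < 1 + e /\ forall z, `|z| = r -> delta.[z] != 0.
Proof.
move=> e_gt0.
have avoid (l : seq C) (b : C) : 1 < b ->
    exists r, [/\ 1 < r, r < b & forall z, z \in l -> `|z| != r].
  elim: l b => [|x l IH] b b1.
    by exists ((1 + b) / 2); rewrite midf_lt // midf_lt.
  have [r [r1 rb rl]] := IH b b1.
  have [xr|xr] := eqVneq `|x| r; last first.
    by exists r; split=> // z; rewrite inE => /orP[/eqP ->|/rl].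
  have [r' [r'1 r'r r'l]] := IH r r1; exists r'; split=> //.
    exact: lt_trans rb.
  by move=> z; rewrite inE => /orP[/eqP ->|/r'l //]; rewrite xr gt_eqF.
have [l lE] := closed_field_poly_normal delta.
have [|r [r1 re rl]] := avoid l (1 + e); first by rewrite ltrDl.
exists r; split=> [|z zr]; first by rewrite r1.
apply/negP; rewrite -[_ == 0]/(root delta z) lE rootZ; last first.
  by rewrite lead_coef_eq0 det_P_neq0.
by rewrite root_prod_XsubC => /rl; rewrite zr eqxx.
Qed.

Section Coefficients.
Variable M_ : int -> 'M[C]_(m, d).
Hypothesis M_laurent : laurent_near_unit_circle sing M M_.

Lemma laurent_summable i k : summableZ (fun j => M_ j i k).
Proof.
have [e [/andP[e0 _] eP]] := M_laurent.
have [|S /(_ i k)/has_sumZP[+ _] _] := eP 1.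
  by rewrite normr1 gtrBl ltrDl e0.
by apply: le_summableZ => j; rewrite !mxE exp1rz mul1r.
Qed.

(** The Laurent coefficients solve [P M = N]: both sides have the same sum on
    a circle without singularities. *)
Lemma laurent_equation i k j :
  \sum_l shift_act (P i l) (fun u => M_ u l k) j = coef_int (poly_N i k) j.
Proof.
have [e [/andP[e0 e1] eP]] := M_laurent.
have [r [/andP[r1 re] r_reg]] := regular_radius e0.
have r_gt0 : 0 < r := lt_trans ltr01 r1.
pose b j := \sum_l shift_act (P i l) (fun u => M_ u l k) j +
            - 1 * coef_int (poly_N i k) j.
have bz z : `|z| = r -> sumsZ (fun j => z ^ j * b j) 0.
  move=> zr; have z0 : z != 0 by rewrite -normr_gt0 zr.
  have dz := r_reg z zr.
  have [|S SM SE] := eP z.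
    by rewrite zr re andbT (lt_trans _ r1) // gtrBl.
  have {}SE : S = M z by apply: SE => /singE /eqP; rewrite (negPf dz).
  have h1 l : sumsZ (fun j => z ^ j * shift_act (P i l) (fun u => M_ u l k) j)
      ((P i l).[z] * S l k).
    apply: laurent_eval => //; have /has_sumZP := SM l k.
    by apply: eq_sumsZ => u; rewrite !mxE.
  have h2 := @sumsZ_sum _ _ (index_enum 'I_m) xpredT _ _ (fun l _ => h1 l).
  have := sumsZD h2 (sumsZZ (-1) (laurent_poly (poly_N i k) z)).
  have -> : \sum_l (P i l).[z] * S l k + -1 * (poly_N i k).[z] = 0.
    have /matrixP/(_ i k) := arma_P_M dz; rewrite -horner_poly_P -SE => h.
    rewrite mulN1r; apply/eqP; rewrite subr_eq0; apply/eqP.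
    transitivity (map_mx (horner_eval z) poly_N i k); last by rewrite mxE.
    by rewrite -h [RHS]mxE; apply: eq_bigr => l _; rewrite [in RHS]mxE.
  apply: eq_sumsZ => u; rewrite /b mulrDr mulr_sumr; congr (_ + _).
  by rewrite mulrCA.
have b0 : b j = 0.
  have rj : r ^ j != 0 by rewrite expfz_neq0 // gt_eqF.
  apply: (mulfI rj); rewrite mulr0.
  apply: (@circle_coef_unique _ (fun j => r ^ j * b j)) => [|z z1].
    by have [] := bz r (gtr0_norm r_gt0).
  have := bz (z * r); rewrite normrM z1 mul1r gtr0_norm // => /(_ erefl).
  by apply: eq_sumsZ => u; rewrite expfzMl mulrA.
by move/eqP: b0; rewrite /b mulN1r subr_eq0 => /eqP.
Qed.

End Coefficients.

End Transfer.

(** * Stationary solutions *)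

Section Solutions.
Context {disp : measure_display} {T : measurableType disp} {R : realType}.
Variable Pr : probability T R.
Local Notation C := R[i].
Local Notation m2 X := (\int[Pr]_w normsq (X w))%R.
Variables (m d p q s : nat) (s_le_d : (s <= d)%N).
Variables (Z : int -> T -> 'cV[C]_d) (Psi : nat -> 'M[C]_m).
Variables (Theta : nat -> 'M[C]_(m, d)) (U : 'M[C]_d) (D : 'rV[R]_s).
Hypothesis Z_noise : weak_white_noise Pr Z.
Hypothesis U_unitary : U \is unitarymx.
Hypothesis D_gt0 : forall i, 0 < D 0 i.
Hypothesis U_diag : U *m vcovariance Pr (Z 0) (Z 0) *m (U ^t*)%sesqui =
  corner_mx s_le_d (diag_mx (map_mx (real_complex R) D)).

Local Notation EZ := (vexpectation Pr (Z 0)).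
Local Notation P := (poly_P p Psi).
Local Notation Q := (poly_Q q Theta).
Local Notation QU := (poly_QU q Theta U).
Local Notation N := (poly_N q s Theta U).
Local Notation delta := (det_P p Psi).
Local Notation M := (arma_M p q s_le_d Psi Theta U).
Local Notation sing := (arma_sing p Psi).
Local Notation W := (rotated Pr Z U).

Section Necessity.
Variable Y : int -> T -> 'cV[C]_m.
Hypothesis Y_ws : weakly_stationary Pr Y.
Hypothesis Y_sol : arma_solution Pr p q Psi Theta Z Y.

Lemma solution_mean :
  arma_P p Psi 1 *m vexpectation Pr (Y 0) = arma_Q q Theta 1 *m EZ.
Proof.
have [Z_ws _] := Z_noise.
have Yi j u : csqint Pr (fun w => Y u w j 0) by exact: ws_csqint.
have Zi j u : csqint Pr (fun w => Z u w j 0) by exact: ws_csqint.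
have cint_act a b (A : 'M[{poly C}]_(a, b)) (X : int -> T -> 'cV[C]_b) i :
    (forall j u, csqint Pr (fun w => X u w j 0)) ->
    csqint Pr (fun w => mx_act A (fun j u => X u w j 0) i 0).
  move=> Xi; apply: csqint_sum => l _.
  exact: (@csqint_filter _ _ _ _ (A i l) (fun u w => X u w l 0)).
have cE_act a b (A : 'M[{poly C}]_(a, b)) (X : int -> T -> 'cV[C]_b) i :
    weakly_stationary Pr X ->
    cexpectation Pr (fun w => mx_act A (fun j u => X u w j 0) i 0) =
    (map_mx (horner_eval 1) A *m vexpectation Pr (X 0)) i 0.
  move=> X_ws; have Xi j u : csqint Pr (fun w => X u w j 0) by exact: ws_csqint.
  rewrite -(mx_act_cst A _ i 0) cexpectation_sum => [|l _].
    apply: eq_bigr => l _.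
    rewrite (@cexpectation_shift_act _ _ _ Pr (A i l) (fun u w => X u w l 0)) //.
      by apply: eq_shift_act => u; rewrite (ws_mean X_ws).
    by move=> u; exact: csqint_cint.
  apply: csqint_cint.
  exact: (@csqint_filter _ _ _ _ (A i l) (fun u w => X u w l 0)).
apply/matrixP => i j; rewrite (ord1 j).
rewrite -horner_poly_P -horner_poly_Q -!cE_act //.
have [Yc _] := cint_act _ _ P Y i Yi; have [Zc _] := cint_act _ _ Q Z i Zi.
apply: cexpectation_ae_eq => //.
have [_] := Y_sol; apply: filterS => w YZ.
by rewrite mx_act_poly_P (mx_act_poly_Q q Theta (fun u => Z u w)) YZ.
Qed.

(** Multiplying the centred equation [P(B) y = QU(B) W] by the adjugate of [P]
    decouples it into scalar equations [det P(B) y_i = sum_k h_k(B) W_k]. *)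
Lemma solution_removable : removable_on_unit_circle sing M.
Proof.
move=> lambda lam1 _ i k; apply/removable_entry; rewrite /numer.
case: ltnP => [ks|_]; last by rewrite gcd0p divpp ?det_P_neq0 // hornerC oner_eq0.
pose y t w := centred Pr Y i t w.
pose B := complex.Re (vcovariance Pr (Y 0) (Y 0) i i).
have yB : bounded_process Pr y B.
  by move=> t; split; [exact: centred_csqint|rewrite centred_m2].
apply: (@pole_free _ _ _ Pr _ W (noise_var D) (fun k => (\adj P *m QU) i k) _ y B).
- by move=> l t; exact: rotated_csqint.
- by move=> l l' t t'; exact: (ip_rotated Z_noise U_diag).
- exact: noise_var_ge0.
- exact: yB.
- have [_] := Y_sol; apply: filterS => w YZ t.
  have eqC u l : mx_act P (fun j u => centred Pr Y j u w) l u =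
      mx_act QU (fun k u => W k u w) l u.
    rewrite -mx_act_rotated //.
    exact: (arma_centred (Y ^~ w) (Z ^~ w) u solution_mean).1 (YZ u) l.
  have := @mx_act_scalar _ m delta (fun j u => centred Pr Y j u w) i t.
  rewrite -mul_adj_mx mx_actM => adjP.
  rewrite [LHS](esym adjP).
  transitivity (mx_act (\adj P) (mx_act QU (fun k u => W k u w)) i t).
    by apply: eq_mx_act => l u; exact: eqC.
  by rewrite -mx_actM.
- exact: det_P_neq0.
- exact: noise_var_gt0.
- exact: lam1.
Qed.

End Necessity.

Section Sufficiency.
Variables (g : 'cV[C]_m) (M_ : int -> 'M[C]_(m, d)).
Hypothesis g_mean : arma_P p Psi 1 *m g = arma_Q q Theta 1 *m EZ.
Hypothesis M_laurent : laurent_near_unit_circle sing M M_.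

Definition noise_filter (i : 'I_m) (k : 'I_d) (t : int) : T -> C :=
  filter_sum (fun j => M_ j i k) (fun j => W k (t - j)).

Definition solution (t : int) (w : T) : 'cV[C]_m :=
  g + \col_i \sum_k noise_filter i k t w.

Let B := \sum_(k : 'I_d) noise_var D k.

Let Wb k t : csqint Pr (W k t) /\ m2 (W k t) <= B.
Proof.
split; first exact: rotated_csqint.
rewrite (rotated_m2 Z_noise U_diag) /B (bigD1 k) //= lerDl.
by apply: sumr_ge0 => l _; exact: noise_var_ge0.
Qed.

Let Wi k t : csqint Pr (W k t) := (Wb k t).1.
Let Wm k t : m2 (W k t) <= B := (Wb k t).2.

Lemma noise_filter_csqint i k t : csqint Pr (noise_filter i k t).
Proof.
have [A cA] := summableZ_rnorm (laurent_summable M_laurent i k).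
exact: csqint_filter_sum cA (fun j => Wi k (t - j)) (fun j => Wm k (t - j)).
Qed.

Lemma noise_filter_mean i k t : cexpectation Pr (noise_filter i k t) = 0.
Proof.
apply: (cexpectation_filter_sum (laurent_summable M_laurent i k)
  (fun j => Wb k (t - j))) => j.
exact: rotated_mean.
Qed.

Lemma noise_filter_sums : {ae Pr, forall w t i k,
  sumsZ (fun j => M_ j i k * W k (t - j) w) (noise_filter i k t w)}.
Proof.
apply: ae_forall_int => t; apply: ae_forall_fin => i; apply: ae_forall_fin => k.
have [A cA] := summableZ_rnorm (laurent_summable M_laurent i k).
exact: filter_sum_sums cA (fun j => Wi k (t - j)) (fun j => Wm k (t - j)).
Qed.

Lemma solution_csqint t i : csqint Pr (fun w => solution t w i 0).
Proof.
rewrite (_ : (fun w => _) = fun w => g i 0 + \sum_k noise_filter i k t w).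
  apply: csqintD; first exact: csqint_cst.
  by apply: csqint_sum => k _; exact: noise_filter_csqint.
by apply/funext => w; rewrite !mxE.
Qed.

Lemma solution_vexpectation t : vexpectation Pr (solution t) = g.
Proof.
apply/matrixP => i j; rewrite (ord1 j) mxE.
rewrite (_ : (fun w => _) = fun w => g i 0 + \sum_k noise_filter i k t w).
  rewrite cexpectationD; first last.
  - by apply: cint_sum => k _; exact/csqint_cint/noise_filter_csqint.
  - exact: cint_cst.
  rewrite cexpectation_cst cexpectation_sum => [|k _].
    by rewrite big1 ?addr0 // => k _; exact: noise_filter_mean.
  exact/csqint_cint/noise_filter_csqint.
by apply/funext => w; rewrite !mxE.
Qed.

(** The covariances of [W] at two times depend on the difference of the times
    only. *)
Lemma ip_noise_filter i k i' k' h t t' :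
  ip Pr (noise_filter i k t) (noise_filter i' k' (t + h)) =
  ip Pr (noise_filter i k t') (noise_filter i' k' (t' + h)).
Proof.
apply: (ip_filter_sum (laurent_summable M_laurent i k)
  (laurent_summable M_laurent i' k') (fun j => Wb k (t - j))
  (fun j => Wb k' (t + h - j)) (fun j => Wb k (t' - j))
  (fun j => Wb k' (t' + h - j))) => u v.
rewrite !(ip_rotated Z_noise U_diag).
by rewrite -!addrA !(inj_eq (addrI _)).
Qed.

Lemma solution_stationary : weakly_stationary Pr solution.
Proof.
split.
- by move=> t; have [] := coord_finite_second_moment (solution_csqint t).
- by move=> t; have [] := coord_finite_second_moment (solution_csqint t).
- move=> t t'.
  exact: etrans (solution_vexpectation t) (esym (solution_vexpectation t')).
move=> h t t'; apply/matrixP => i i'.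
have devE u j : (fun w => solution u w j 0 - g j 0) =
                (fun w => \sum_k 1 * noise_filter j k u w).
  apply/funext => w; rewrite /solution !mxE addrAC subrr add0r.
  by apply: eq_bigr => k _; rewrite mul1r.
have covE u : vcovariance Pr (solution u) (solution (u + h)) i i' =
    \sum_k \sum_k' ip Pr (noise_filter i k u) (noise_filter i' k' (u + h)).
  have := vcovarianceE i i' (solution_vexpectation u)
    (solution_vexpectation (u + h)).
  rewrite (devE u) (devE (u + h)) => ->.
  have nfi := noise_filter_csqint.
  rewrite ip_suml //; last by apply: csqint_sum => k _; exact: csqintZ.
  apply: eq_bigr => k _; rewrite mul1r ip_sumr //.
  by apply: eq_bigr => k' _; rewrite conjC1 mul1r.
apply: etrans (covE t) _; apply: etrans _ (esym (covE t')).
apply: eq_bigr => k _; apply: eq_bigr => k' _.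
exact: ip_noise_filter.
Qed.

(** Pathwise, [P(B)] acts on the output of the filter by acting on its
    coefficients, which turns the Laurent expansion of [M] into that of
    [P M = N]. *)
Lemma solution_solves : arma_solution Pr p q Psi Theta Z solution.
Proof.
split; first by have [] := solution_stationary.
have W0 : {ae Pr, forall w t (k : 'I_d), (s <= k)%N -> W k t w = 0}.
  apply: ae_forall_int => t; apply: ae_forall_fin => k.
  case: (leqP s k) => [sk|_]; last exact: nearW.
  by apply: filterS (rotated_eq0 Z_noise U_diag t sk).
apply: filterS2 noise_filter_sums W0 => w sums Wz t.
apply: (arma_centred (solution ^~ w) (Z ^~ w) t g_mean).2 => i.
transitivity (mx_act QU (fun k u => W k u w) i t); last first.
  by symmetry; exact: (mx_act_rotated Pr Z U_unitary).
transitivity (\sum_k \sum_l shift_act (P i l) (fun u => noise_filter l k u w) t).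
  rewrite exchange_big; apply: eq_bigr => l _; rewrite -shift_act_sumr.
  by apply: eq_shift_act => u; rewrite /solution !mxE addrAC subrr add0r.
apply: eq_bigr => k _.
have h1 : sumsZ (fun j => coef_int (N i k) j * W k (t - j) w)
    (\sum_l shift_act (P i l) (fun u => noise_filter l k u w) t).
  have h l : sumsZ (fun j => shift_act (P i l) (fun u => M_ u l k) j * W k (t - j) w)
      (shift_act (P i l) (fun u => noise_filter l k u w) t).
    exact: (@sumsZ_shift_act _ (P i l) (fun u => M_ u l k) (fun u => W k u w)).
  have := @sumsZ_sum _ _ (index_enum 'I_m) xpredT _ _ (fun l _ => h l).
  by apply: eq_sumsZ => j; rewrite -mulr_suml (laurent_equation M_laurent).
have h2 := sumsZ_coef_int (N i k) (fun u => W k u w) t.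
rewrite (sumsZ_unique h1 h2) mxE; case: ltnP => // sk.
rewrite shift_act0l /shift_act big1 // => l _.
by rewrite Wz ?mulr0.
Qed.

Lemma solution_sums t : {ae Pr, forall w,
  mx_has_sumZ (fun j => M_ j *m U *m (Z (t - j) w - EZ)) (solution t w - g)}.
Proof.
apply: filterS noise_filter_sums => w sums i j; apply/has_sumZP.
rewrite (ord1 j) /solution addrC addKr mxE.
have := @sumsZ_sum _ _ (index_enum 'I_d) xpredT _ _ (fun k _ => sums t i k).
apply: eq_sumsZ => u; rewrite -mulmxA mxE.
by apply: eq_bigr => k _.
Qed.

End Sufficiency.

End Solutions.

Local Open Scope sesquilinear_scope.

Theorem theorem2p3 (R : realType) (disp : measure_display)
    (T : measurableType disp) (Pr : probability T R)
    (m d p q s : nat) (m_gt0 : (0 < m)%N) (d_gt0 : (0 < d)%N)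
    (p_gt0 : (0 < p)%N) (s_le_d : (s <= d)%N)
    (Z : int -> T -> 'cV[R[i]]_d) (Sigma : 'M[R[i]]_d)
    (Psi : nat -> 'M[R[i]]_m) (Theta : nat -> 'M[R[i]]_(m, d))
    (U : 'M[R[i]]_d) (D : 'rV[R]_s)
    (Z_noise : weak_white_noise Pr Z)
    (Sigma_cov : Sigma = vcovariance Pr (Z 0) (Z 0))
    (U_unitary : U \is unitarymx)
    (D_gt0 : forall i, 0 < D 0 i)
    (U_diag : U *m Sigma *m U ^t* =
              corner_mx s_le_d (diag_mx (map_mx (real_complex R) D))) :
  let EZ := vexpectation Pr (Z 0) in
  let P := arma_P p Psi in
  let Q := arma_Q q Theta in
  let M := arma_M p q s_le_d Psi Theta U in
  let sing := arma_sing p Psi in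
  ((exists Y : int -> T -> 'cV[R[i]]_m,
      weakly_stationary Pr Y /\ arma_solution Pr p q Psi Theta Z Y)
   <->
   (removable_on_unit_circle sing M /\
    exists g : 'cV[R[i]]_m, P 1 *m g = Q 1 *m EZ))
  /\
  (forall g : 'cV[R[i]]_m,
     removable_on_unit_circle sing M -> P 1 *m g = Q 1 *m EZ ->
     (exists M_ : int -> 'M[R[i]]_(m, d),
        laurent_near_unit_circle sing M M_) /\
     (forall M_ : int -> 'M[R[i]]_(m, d),
        laurent_near_unit_circle sing M M_ ->
        exists Y : int -> T -> 'cV[R[i]]_m,
          [/\ weakly_stationary Pr Y,
              arma_solution Pr p q Psi Theta Z Y &
              forall t : int, {ae Pr, forall w,
                mx_has_sumZ (fun j => M_ j *m U *m (Z (t - j) w - EZ))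
                            (Y t w - g)}])).
Proof.
move=> EZ P Q M sing; subst Sigma.
have main (g : 'cV[R[i]]_m) : removable_on_unit_circle sing M ->
    P 1 *m g = Q 1 *m EZ ->
    (exists M_, laurent_near_unit_circle sing M M_) /\
    (forall M_ : int -> 'M[R[i]]_(m, d), laurent_near_unit_circle sing M M_ ->
      exists Y : int -> T -> 'cV[R[i]]_m,
        [/\ weakly_stationary Pr Y, arma_solution Pr p q Psi Theta Z Y &
            forall t : int, {ae Pr, forall w,
              mx_has_sumZ (fun j => M_ j *m U *m (Z (t - j) w - EZ))
                          (Y t w - g)}]).
  move=> M_rem g_mean; split; first exact: laurent_exists.
  move=> M_ M_laurent; exists (solution Pr Z U g M_); split.
  - exact: (solution_stationary Z_noise D_gt0 U_diag g M_laurent).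
  - exact: (solution_solves Z_noise U_unitary D_gt0 U_diag g_mean M_laurent).
  - exact: (solution_sums Z_noise D_gt0 U_diag g M_laurent).
split; last exact: main.
split=> [[Y [Y_ws Y_sol]]|[M_rem [g g_mean]]].
  split; first exact: (solution_removable Z_noise U_unitary D_gt0 U_diag Y_ws Y_sol).
  exists (vexpectation Pr (Y 0)).
  exact: (solution_mean Z_noise Y_ws Y_sol).
have [[M_ M_laurent] sol] := main g M_rem g_mean.
by have [Y [Y_ws Y_sol _]] := sol M_ M_laurent; exists Y.
Qed.
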